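(* Let $n\in\mathbb{N}$, $n\ge1$, and let $K\in L_1$ satisfy the following condition $N_n^*$: there exist a polynomial $T^*\in H^T_{2n-1}$ and a point $\vartheta\in[0,\pi/n]$ such that $(K(x)-T^*(x))\,\varphi_n(x-\vartheta)\ge0$ for almost every $x$, where $\varphi_n(x)=\operatorname{sgn}\sin nx$. Then for $p=1$ and for $p=\infty$ $$\mathcal{E}\left(K*\Phi_p,SVH^{T}_{2n-1}\right)_{L^A_p}=\mathcal{U}\left(K*\Phi_p,SVH^T_{2n-1}\right)_{L^A_p}=E\left(K*F_p,H^{T}_{2n-1}\right)_{L_p}=\|K*\varphi_n\|_{L_\infty}.$$
   Context: Scalar notation. $L_p$ ($1\le p\le\infty$) is the space of $2\pi$-periodic functions $f:\mathbb{R}\to\mathbb{R}$ with the usual norm $\|f\|_{L_p}=\left(\int_0^{2\pi}|f(x)|^p\,dx\right)^{1/p}$ (essential supremum for $p=\infty$). For $K,\varphi\in L_1$, $K*\varphi(x)=\int_0^{2\pi}K(t)\varphi(x-t)\,dt$. $F_p=\{\varphi\in L_p:\|\varphi\|_{L_p}\le1\}$ and $K*F_p=\{K*\varphi:\varphi\in F_p\}$. $H^T_{2n-1}$ is the $(2n-1)$-dimensional space of real trigonometric polynomials of order at most $n-1$, i.e. of functions $\frac{a_0}{2}+\sum_{k=1}^{n-1}(a_k\cos kx+b_k\sin kx)$, $a_k,b_k\in\mathbb{R}$. For a class $\mathcal{M}\subset L_p$, $E(\mathcal{M},H^T_{2n-1})_{L_p}=\sup_{f\in\mathcal{M}}\inf_{T\in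 H^T_{2n-1}}\|f-T\|_{L_p}$. Set-valued notation. Fix $m\ge1$. $K(\mathbb{R}^m)$ is the set of nonempty compact subsets of $\mathbb{R}^m$, with the Hausdorff metric $\delta$ induced by the Euclidean norm; $\theta$ is the zero vector of $\mathbb{R}^m$ and $\|A\|=\delta(A,\{\theta\})$ for $A\in K(\mathbb{R}^m)$. For $\lambda\in\mathbb{R}$, $\lambda A=\{\lambda a:a\in A\}$. For set-valued $f:[0,2\pi]\to K(\mathbb{R}^m)$ the integral is the Aumann integral $\int_0^{2\pi}f(x)\,dx=\left\{\int_0^{2\pi}\phi(x)\,dx:\ \phi(x)\in f(x)\text{ a.e.},\ \phi\text{ integrable}\right\}$. $L_1^A$ is the set of measurable $2\pi$-periodic functions $f:\mathbb{R}\to K(\mathbb{R}^m)$ with $\|f(\cdot)\|$ integrable on $[0,2\pi]$; for $1\le p\le\infty$, $L_p^A=\{f\in L_1^A:\|f(\cdot)\|\in L_p\}$, with metric $\delta_{L_p^A}(f,g)=\|\delta(f(\cdot),g(\cdot))\|_{L_p}$. Put $\Phi_p=\{f\in L_p^A:\delta_{L_p^A}(f,\{\theta\})\le1\}$, where $\{\theta\}$ denotes the constant function. For $K\in L_1$ and $g\in L_1^A$, $K*g(x)=\int_0^{2\pi}K(x-t)g(t)\,dt$ (Aumann integral; understood for almost every $x$), and $K*\Phi_p=\{K*g:g\in\Phi_p\}$. $SVH^T_{2n-1}$ is the set of all set-valued functions $\tau(x)=\int_0^{2\pi}T(x-t)h(t)\,dt$ with $T\in H^T_{2n-1}$ and $h\in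 L_1^A$. For $1\le p,q\le\infty$ define $$\mathcal{E}(K*\Phi_p,SVH^T_{2n-1})_{L^A_q}=\sup_{f\in K*\Phi_p}\ \inf_{\tau\in SVH^T_{2n-1}}\delta_{L^A_q}(f,\tau),$$ $$\mathcal{U}(K*\Phi_p,SVH^T_{2n-1})_{L^A_q}=\inf_{T\in H^T_{2n-1}}\ \sup_{g\in\Phi_p}\delta_{L^A_q}(K*g,T*g).$$ *)

(* Defs.v *)
From HB Require Import structures.
From mathcomp Require Import all_boot all_order all_algebra.
From mathcomp Require Import all_classical all_reals all_analysis.

Set Implicit Arguments.
Unset Strict Implicit.
Unset Printing Implicit Defensive.

Import Order.TTheory GRing.Theory Num.Theory.
Import numFieldNormedType.Exports.

Local Open Scope classical_set_scope.
Local Open Scope ring_scope.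

(* Measurability on R is with respect to the Borel sigma-algebra, as in the
   library's Lp-spaces: an element of an Lp-space is given by a Borel
   representative. *)

Definition period_itv (R : realType) : set R := `[0, 2 * pi].
Arguments period_itv : clear implicits.

Lemma measurable_period_itv (R : realType) :
  measurable (period_itv R : set (measurableTypeR R)).
Proof. exact: measurable_itv. Qed.
Arguments measurable_period_itv : clear implicits.

Definition period_measure (R : realType) :
    {measure set (measurableTypeR R) -> \bar R} :=
  mrestr (@lebesgue_measure R) (measurable_period_itv R).
Arguments period_measure : clear implicits.

(* Norm over one period of an extended-real-valued function, for
   1 <= p <= +oo; an essential supremum when p = +oo. *)
Definition normLp (R : realType) (p : \bar R) (f : R -> \bar R) : \bar R :=
  'N[period_measure R]_p[f]%E.

Definition Lp (R : realType) (p : \bar R) : set (R -> R) :=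
  [set f | periodic f (2 * pi) /\ f \in Lfun (period_measure R) p].

(* Total: the value is meaningful at every x where the integrand is
   integrable, hence at almost every x when K and phi are in Lp 1. *)
Definition convolution (R : realType) (K phi : R -> R) : R -> R :=
  fun x => \int[lebesgue_measure]_(t in period_itv R) (K t * phi (x - t)).

Definition F_ball (R : realType) (p : \bar R) : set (R -> R) :=
  [set phi | Lp p phi /\ (normLp p (EFin \o phi) <= 1)%E].

Definition conv_class (R : realType) (K : R -> R) (p : \bar R) :
    set (R -> R) :=
  [set convolution K phi | phi in F_ball p].

(* The (2n-1)-dimensional space H^T_{2n-1}: order at most n - 1. *)
Definition trigpoly (R : realType) (n : nat) : set (R -> R) :=
  [set T | exists a b : nat -> R, T = fun x =>
     a 0%N / 2 +
     \sum_(1 <= k < n) (a k * cos (k%:R * x) + b k * sin (k%:R * x))].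
Arguments trigpoly {R} n.

Definition best_approx (R : realType) (M H : set (R -> R)) (p : \bar R) :
    \bar R :=
  ereal_sup [set ereal_inf [set normLp p (EFin \o (f \- T)) | T in H]
            | f in M].

Definition phi_n (R : realType) (n : nat) : R -> R :=
  fun x => Num.sg (sin (n%:R * x)).

Definition cond_Nstar (R : realType) (n : nat) (K : R -> R) : Prop :=
  exists (T : R -> R) (theta : R),
    [/\ trigpoly n T, 0 <= theta <= pi / n%:R &
        {ae (@lebesgue_measure R), forall x,
           0 <= (K x - T x) * phi_n n (x - theta)}].

(* The library's norm on row vectors is the max norm; its topology, used below
   for [compact] and [open], is the Euclidean one. *)
Definition enorm (R : realType) (m : nat) (u : 'rV[R]_m) : R :=
  Num.sqrt (\sum_(i < m) u 0 i ^+ 2).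

(* Extended-real-valued because it is applied to arbitrary sets; it is finite,
   and is the usual Hausdorff metric, on nonempty compact sets. *)
Definition hausdorff (R : realType) (m : nat) (A B : set 'rV[R]_m) : \bar R :=
  maxe
    (ereal_sup [set ereal_inf [set (enorm (a - b))%:E | b in B] | a in A])
    (ereal_sup [set ereal_inf [set (enorm (a - b))%:E | a in A] | b in B]).

Definition set_norm (R : realType) (m : nat) (A : set 'rV[R]_m) : \bar R :=
  hausdorff A [set 0].

Definition compact_valued (R : realType) (m : nat) (f : R -> set 'rV[R]_m) :
    Prop :=
  forall x, compact (f x) /\ f x !=set0.

(* For functions with nonempty compact values this is the same as requiring the
   preimages of closed sets to be measurable, or as measurability for the Borel
   sigma-algebra of the Hausdorff metric. *)
Definition sv_measurable (R : realType) (m : nat) (f : R -> set 'rV[R]_m) :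
    Prop :=
  forall U : set 'rV[R]_m, open U ->
    measurable ([set x | f x `&` U !=set0] : set (measurableTypeR R)).

Definition aumann (R : realType) (m : nat) (F : R -> set 'rV[R]_m) :
    set 'rV[R]_m :=
  [set v | exists phi : R -> 'rV[R]_m,
    [/\ forall i, (@lebesgue_measure R).-integrable (period_itv R)
                    (fun t => (phi t 0 i)%:E),
        {ae (@lebesgue_measure R), forall t, period_itv R t -> F t (phi t)} &
        v = \row_i (\int[lebesgue_measure]_(t in period_itv R) phi t 0 i)]].

Definition L1A (R : realType) (m : nat) : set (R -> set 'rV[R]_m) :=
  [set f | [/\ compact_valued f, sv_measurable f, (forall x, f (x + 2 * pi) = f x) &
     (@lebesgue_measure R).-integrable (period_itv R)
       (fun x => set_norm (f x))]].
Arguments L1A : clear implicits.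

Definition LpA (R : realType) (m : nat) (p : \bar R) :
    set (R -> set 'rV[R]_m) :=
  [set f | L1A R m f /\ Lp p (fun x => fine (set_norm (f x)))].

Definition distLpA (R : realType) (m : nat) (p : \bar R)
    (f g : R -> set 'rV[R]_m) : \bar R :=
  normLp p (fun x => hausdorff (f x) (g x)).

Definition Phi (R : realType) (m : nat) (p : \bar R) :
    set (R -> set 'rV[R]_m) :=
  [set f | LpA p f /\ (distLpA p f (fun=> [set 0%R]) <= 1)%E].
Arguments Phi {R} m p.

(* For K in Lp 1 and g in L1A the value is a nonempty compact set at almost
   every x; the values at the remaining points do not affect [distLpA]. *)
Definition svconv (R : realType) (m : nat) (K : R -> R)
    (g : R -> set 'rV[R]_m) : R -> set 'rV[R]_m :=
  fun x => aumann (fun t => [set K (x - t) *: a | a in g t]).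

Definition svconv_class (R : realType) (m : nat) (K : R -> R) (p : \bar R) :
    set (R -> set 'rV[R]_m) :=
  [set svconv K g | g in Phi m p].
Arguments svconv_class {R} m K p.

Definition SVH (R : realType) (m n : nat) : set (R -> set 'rV[R]_m) :=
  [set tau | exists (T : R -> R) (h : R -> set 'rV[R]_m),
     [/\ trigpoly n T, L1A R m h & tau = svconv T h]].
Arguments SVH {R} m n.

Definition calE (R : realType) (m n : nat) (K : R -> R) (p q : \bar R) :
    \bar R :=
  ereal_sup [set ereal_inf [set distLpA q f tau | tau in SVH m n]
            | f in svconv_class m K p].

Definition calU (R : realType) (m n : nat) (K : R -> R) (p q : \bar R) :
    \bar R :=
  ereal_inf [set ereal_sup [set distLpA q (svconv K g) (svconv T g)
                           | g in Phi m p]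
            | T in trigpoly n].

(* Main.v *)
Require Import Defs.
From HB Require Import structures.
From mathcomp Require Import all_boot all_order all_algebra.
From mathcomp Require Import all_classical all_reals all_analysis.
From mathcomp Require Import ess_sup_inf measurable_realfun ring lra.

(** Let [T] and [theta] witness the sign condition, let [delta] be the integral of
    [|K - T|] over a period, and let [N] be the uniform norm of the convolution
    of [K] with [phi_n].  With [E] the scalar approximation error, all the
    quantities of the theorem are caught in the cycle
    [N <= E <= calE <= calU <= delta <= N].

    - [delta <= N]: [phi_n] is orthogonal to trigonometric polynomials of order
      less than [n], so convolving it with [K] or with [K - T] gives the same
      function.  At [theta] the sign condition makes the integrand equal to
      [- |K - T|] almost everywhere, so this function has absolute value [delta]
      there, and it is continuous ([kernel_norm_le]).

    - [calU <= delta]: an integrable selection of [K (x - t) *: g t] is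
      [K (x - t)] times a measurable selection of [g], and the same selection
      used with [T] gives a point of the other Aumann integral.  Hence the
      Hausdorff distance of the two convolutions at [x] is at most the
      convolution of [|K - T|] with the norm of [g], and Young's inequality for
      the exponents [1] and [+oo] applies ([distLpA_svconv_le]).

    - [calE <= calU] holds because the convolution of [T] with [g] is an
      admissible approximant.

    - [E <= calE]: scalar functions embed as singletons along a coordinate axis,
      and a selection of a set-valued approximant is a scalar approximant that
      is at least as good ([best_approx_le_calE]).

    - [N <= E]: a translation by [pi / n] changes the sign of [phi_n], hence of
      its convolution [f] with [K], whereas the alternating sum over the [2n]
      translates by multiples of [pi / n] annihilates trigonometric polynomials
      ([sum_alternating_trigpoly]).  In the uniform norm, apply this sum to
      [f - T] ([best_approx_infty_ge]).  In the mean norm, test against the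
      reflected [phi_n]: polynomials disappear, and by Fubini what remains is
      the integral of [phi] against the reflected [f], which comes close to [N]
      when [phi] is concentrated where [|f|] is large ([best_approx_one_ge]).

    Both places where set-valued functions meet scalar ones rest on the
    existence of measurable selections ([measurable_selection]). *)

Import Order.TTheory GRing.Theory Num.Theory.
Import numFieldNormedType.Exports.
Set Implicit Arguments.
Unset Strict Implicit.
Unset Printing Implicit Defensive.
Local Open Scope classical_set_scope.
Local Open Scope ring_scope.

(** * Integrals over one period *)

Section period_integral.
Variable R : realType.
Implicit Types (f g : R -> \bar R) (c : R).
Notation mu := (@lebesgue_measure R).
Notation P := (period_itv R).

Lemma lebesgue_translation c (A : set R) :
  measurable A -> mu ((fun x => c + x) @^-1` A) = mu A.
Proof.
have mc : measurable_fun [set: measurableTypeR R]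
    ((fun x => c + x) : measurableTypeR R -> measurableTypeR R).
  exact: measurable_funD.
move=> mA; apply/esym.
have := @lebesgue_measure_unique R (pushforward mu
  ((fun x => c + x) : measurableTypeR R -> measurableTypeR R)).
rewrite /pushforward; apply => // _ [[a b] _ <-].
transitivity (mu (`]a - c, b - c]%classic : set R)); last first.
  congr (mu _); apply/seteqP; split => x /=; rewrite !in_itv/= => /andP[? ?];
    by apply/andP; split; lra.
rewrite !lebesgue_measure_itv/= !lte_fin ltrD2r -EFinB.
by congr (if _ then _ else _); rewrite -EFinB; congr (_%:E); ring.
Qed.

Lemma ge0_integral_translation c (A : set R) f :
  measurable A -> measurable_fun setT f -> (forall x, (0 <= f x)%E) ->
  (\int[mu]_(x in (fun x => (c + x)%R) @^-1` A) f (c + x)%R =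
   \int[mu]_(x in A) f x)%E.
Proof.
have mc : measurable_fun [set: measurableTypeR R]
    ((fun x => c + x) : measurableTypeR R -> measurableTypeR R).
  exact: measurable_funD.
move=> mA mf f0.
rewrite -(@ge0_integral_pushforward _ _ _ _ R _ mc mu A f) //; last first.
  exact: measurable_funTS.
by apply: eq_measure_integral => B mB _; exact: lebesgue_translation.
Qed.

Lemma ge0_integral_reflection (A : set R) f :
  measurable A -> measurable_fun setT f -> (forall x, (0 <= f x)%E) ->
  (\int[mu]_(x in -%R @^-1` A) f (- x)%R = \int[mu]_(x in A) f x)%E.
Proof.
move=> mA mf f0.
have mN : measurable_fun [set: measurableTypeR R]
  (-%R : measurableTypeR R -> measurableTypeR R) by [].
rewrite -(@ge0_integral_pushforward _ _ _ _ R _ mN mu A f) //; last first.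
  exact: measurable_funTS.
by apply: eq_measure_integral => B mB _; exact: lebesgue_measureN.
Qed.

Lemma periodicz (T : Type) (h : R -> T) (L : R) :
  (forall x, h (x + L) = h x) -> forall (k : int) x, h (x + k%:~R * L) = h x.
Proof.
move=> hL; have hn n x : h (x + n%:R * L) = h x.
  elim: n x => [|n IH] x; first by rewrite mul0r addr0.
  by rewrite -natr1 mulrDl mul1r addrA hL IH.
by case=> n x; [exact: hn|rewrite NegzE -(hn n.+1) mulrNz mulNr subrK].
Qed.

(** The part of the interval beyond [2 * pi] is moved back by one period, onto
    the interval from [0] to [a]. *)
Lemma ge0_integral_any_period f a :
  measurable_fun setT f -> (forall x, (0 <= f x)%E) ->
  (forall x, f (x + 2 * pi)%R = f x) -> 0 <= a <= 2 * pi ->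
  (\int[mu]_(x in `]a, (a + 2 * pi)%R]) f x = \int[mu]_(x in P) f x)%E.
Proof.
move=> mf f0 fL /andP[a0 aL].
rewrite -[RHS]integral_itv_obnd_cbnd; last exact: measurable_funTS.
have split_at (u v w : R) : u <= v -> v <= w ->
    (\int[mu]_(x in `]u, w]) f x =
     \int[mu]_(x in `]u, v]) f x + \int[mu]_(x in `]v, w]) f x)%E.
  move=> uv vw.
  have -> : `]u, w]%classic = `]u, v] `|` `]v, w].
    by rewrite -itv_bndbnd_setU// bnd_simp.
  rewrite ge0_integral_setU//; first exact: measurable_funTS.
  apply/disj_setPS => x []/=; rewrite !in_itv/= => /andP[_ xv] /andP[vx _].
  by move: (lt_le_trans vx xv); rewrite ltxx.
rewrite (split_at a (2 * pi)%R)//; last by lra.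
rewrite (split_at 0%R a (2 * pi)%R)// addeC; congr (_ + _)%E.
rewrite -(@ge0_integral_translation (2 * pi)%R `](2 * pi)%R, (a + 2 * pi)%R])//.
rewrite [X in integral _ X](_ : _ = `]0%R, a]%classic); last first.
  by apply/seteqP; split => x /=; rewrite !in_itv/= => /andP[? ?];
    apply/andP; split; lra.
by apply: eq_integral => x _; rewrite addrC fL.
Qed.

Lemma ge0_integral_period_shift f c :
  measurable_fun setT f -> (forall x, (0 <= f x)%E) ->
  (forall x, f (x + 2 * pi)%R = f x) ->
  (\int[mu]_(x in P) f (c + x)%R = \int[mu]_(x in P) f x)%E.
Proof.
move=> mf f0 fL; have L0 : 0 < 2 * pi :> R by rewrite mulr_gt0// pi_gt0.
(* [a] is the translation [c] reduced modulo the period. *)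
pose k := Num.floor (c / (2 * pi)); pose a := c - k%:~R * (2 * pi).
have a_itv : 0 <= a <= 2 * pi.
  have /andP[k1 k2] := mem_rg1_floor (c / (2 * pi)).
  move: k1 k2; rewrite -/k ler_pdivlMr// ltr_pdivrMr// mulrDl.
  by rewrite /a => *; apply/andP; split; lra.
transitivity (\int[mu]_(x in P) f (a + x)%R)%E.
  apply: eq_integral => x _; rewrite -[in RHS](periodicz fL k) /a.
  by congr (f _); ring.
rewrite -(ge0_integral_any_period mf f0 fL a_itv).
rewrite -(@ge0_integral_translation a `]a, (a + 2 * pi)%R])//.
rewrite [X in _ = integral _ X _](_ : _ = `]0, 2 * pi]%classic); last first.
  by apply/seteqP; split => x /=; rewrite !in_itv/= => /andP[? ?];
    apply/andP; split; lra.
rewrite integral_itv_obnd_cbnd//; apply: measurable_funTS.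
by apply: measurableT_comp mf _; exact: measurable_funD.
Qed.

Lemma ge0_integral_period_reflect f c :
  measurable_fun setT f -> (forall x, (0 <= f x)%E) ->
  (forall x, f (x + 2 * pi)%R = f x) ->
  (\int[mu]_(x in P) f (c - x)%R = \int[mu]_(x in P) f x)%E.
Proof.
move=> mf f0 fL; pose g x := f (c + x).
have mg : measurable_fun setT g.
  by apply: measurableT_comp mf _; exact: measurable_funD.
have g0 x : (0 <= g x)%E by exact: f0.
pose A : set R := [set` `[- (2 * pi), 0]].
have mA : measurable (A : set (measurableTypeR R)) by exact: measurable_itv.
have AN : P = -%R @^-1` A.
  by rewrite /A /period_itv; apply/seteqP; split => x /=; rewrite !in_itv/=;
    move=> /andP[? ?]; apply/andP; split; lra.
have AT : P = (fun x => - (2 * pi) + x) @^-1` A.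
  by rewrite /A /period_itv; apply/seteqP; split => x /=; rewrite !in_itv/=;
    move=> /andP[? ?]; apply/andP; split; lra.
rewrite -(ge0_integral_period_shift c mf f0 fL) {1}AN.
rewrite (@ge0_integral_reflection A g)//.
rewrite -(@ge0_integral_translation (- (2 * pi))%R A g)//.
rewrite [X in integral _ X _ = _](_ : _ = P); last exact/esym/AT.
apply: eq_integral => x _.
by rewrite /g -[LHS]fL; congr (f _); ring.
Qed.
End period_integral.

Section period_measure_theory.
Variable R : realType.
Implicit Types (f : R -> \bar R) (c : R).
Notation mu := (@lebesgue_measure R).
Notation P := (period_itv R).
Notation mP := (measurable_period_itv R).

Lemma lebesgue_measure_period : mu P = (2 * pi)%:E.
Proof.
by rewrite lebesgue_measure_itv/= lte_fin mulr_gt0 ?pi_gt0// -EFinB subr0.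
Qed.

Lemma lebesgue_measure_period_lty : (mu P < +oo)%E.
Proof. by rewrite lebesgue_measure_period ltry. Qed.

(** [period_measure] as a finite measure, as Fubini's theorem needs a sigma-finite
    one; the two measures are convertible. *)
Definition period_mu : set (measurableTypeR R) -> \bar R :=
  mfrestr mP lebesgue_measure_period_lty.

HB.instance Definition _ := FiniteMeasure.on period_mu.

Lemma period_muE (A : set (measurableTypeR R)) : period_mu A = mu (A `&` P). Proof. by []. Qed.

Lemma period_muT_gt0 : (0 < period_mu setT)%E.
Proof. by rewrite period_muE setTI lebesgue_measure_period lte_fin mulr_gt0// pi_gt0. Qed.

Lemma ge0_integral_period_mu f : measurable_fun setT f -> (forall x, (0 <= f x)%E) ->
  (\int[period_mu]_x f x = \int[mu]_(x in P) f x)%E.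
Proof.
move=> mf f0; rewrite -(setUv P) ge0_integral_setU//; last 4 first.
- exact: (measurable_period_itv R).
- exact: measurableC (measurable_period_itv R).
- by rewrite setUv.
- by apply/disj_setPS; rewrite setICr.
rewrite [X in (_ + X)%E](_ : _ = 0%E) ?adde0.
  apply: eq_measure_integral => A mA AP.
  by rewrite /= period_muE; congr (mu _); exact: setIidl.
rewrite (eq_measure_integral mzero) ?integral_measure_zero// => A mA AP.
rewrite /= period_muE (_ : A `&` P = set0) ?measure0//.
by apply/disjoints_subset.
Qed.

Lemma integral_period_mu f : measurable_fun setT f ->
  (\int[period_mu]_x f x = \int[mu]_(x in P) f x)%E.
Proof.
move=> mf; rewrite [LHS]integralE [RHS]integralE !ge0_integral_period_mu//.
  exact: measurable_funeneg.
exact: measurable_funepos.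
Qed.

Lemma integrable_period_mu f : measurable_fun setT f ->
  period_mu.-integrable setT f <-> mu.-integrable P f.
Proof.
move=> mf; have mnf : measurable_fun setT (fun x => `|f x|%E).
  exact: measurableT_comp.
split=> /integrableP[_ foo]; apply/integrableP; split.
- exact: measurable_funTS.
- by rewrite -ge0_integral_period_mu.
- exact: mf.
- by rewrite ge0_integral_period_mu.
Qed.

Lemma ae_period_mu (Q : R -> Prop) :
  {ae period_mu, forall x, Q x} <-> {ae mu, forall x, P x -> Q x}.
Proof.
split=> -[N [mN N0 QN]].
  exists (N `&` P); split => //; first exact: measurableI mN mP.
  by move=> x /= /not_implyP[Px nQ]; split => //; exact: QN.
exists (N `|` ~` P); split.
- exact: measurableU mN (measurableC mP).
- rewrite period_muE setIUl setICl setU0; apply/eqP; rewrite -measure_le0 -[leRHS]N0.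
  by apply: le_measure; rewrite ?inE//; exact: measurableI mN mP.
- move=> x /= nQ; have [Px|] := pselect (P x); last by right.
  by left; apply: QN => h; apply: nQ; exact: h Px.
Qed.

Lemma integral_period_shift f c : measurable_fun setT f ->
  (forall x, f (x + 2 * pi)%R = f x) ->
  (\int[mu]_(x in P) f (c + x)%R = \int[mu]_(x in P) f x)%E.
Proof.
move=> mf fL; rewrite [LHS]integralE [RHS]integralE.
congr (_ - _)%E.
- rewrite -(@ge0_integral_period_shift _ f^\+%E c)//.
  + by apply: eq_integral => x _; rewrite !funeposE.
  + exact: measurable_funepos.
  + by move=> x; rewrite !funeposE fL.
- rewrite -(@ge0_integral_period_shift _ f^\-%E c)//.
  + by apply: eq_integral => x _; rewrite !funenegE.
  + exact: measurable_funeneg.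
  + by move=> x; rewrite !funenegE fL.
Qed.

Lemma integral_period_reflect f c : measurable_fun setT f ->
  (forall x, f (x + 2 * pi)%R = f x) ->
  (\int[mu]_(x in P) f (c - x)%R = \int[mu]_(x in P) f x)%E.
Proof.
move=> mf fL; rewrite [LHS]integralE [RHS]integralE.
congr (_ - _)%E.
- rewrite -(@ge0_integral_period_reflect _ f^\+%E c)//.
  + by apply: eq_integral => x _; rewrite !funeposE.
  + exact: measurable_funepos.
  + by move=> x; rewrite !funeposE fL.
- rewrite -(@ge0_integral_period_reflect _ f^\-%E c)//.
  + by apply: eq_integral => x _; rewrite !funenegE.
  + exact: measurable_funeneg.
  + by move=> x; rewrite !funenegE fL.
Qed.

(** The exceptional set is periodic, so its measure over a period is the
    integral of a periodic indicator and does not change under translation. *)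
Lemma ae_period_shift (Q : R -> Prop) c :
  measurable ([set x | ~ Q x] : set (measurableTypeR R)) ->
  (forall x, Q (x + 2 * pi) = Q x) ->
  {ae period_mu, forall x, Q x} -> {ae period_mu, forall x, Q (c + x)}.
Proof.
set A := [set x | ~ Q x] => mA QL [N [mN N0 QN]].
have pA0 : period_mu A = 0%E.
  by apply/eqP; rewrite -measure_le0 -[leRHS]N0; apply: le_measure; rewrite ?inE.
pose B : set R := [set x | ~ Q (c + x)].
have mB : measurable (B : set (measurableTypeR R)).
  rewrite -[X in measurable X]setTI.
  have mc : measurable_fun [set: R] (fun x : R => c + x) by exact: measurable_funD.
  exact: (mc measurableT _ mA).
have ind (C : set (measurableTypeR R)) : measurable C ->
    period_mu C = (\int[mu]_(x in P) (\1_C x)%:E)%E.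
  move=> mC; rewrite -ge0_integral_period_mu ?integral_indic ?setIT//.
  by apply/measurable_EFinP; exact: measurable_indic.
exists B; split => //; rewrite -[RHS]pA0 !ind//.
rewrite -[RHS](@ge0_integral_period_shift _ _ c)//.
- by apply/measurable_EFinP; exact: measurable_indic.
- move=> x; rewrite !indicE; congr ((nat_of_bool _)%:R%:E).
  by apply/idP/idP; rewrite !inE /A/= QL.
Qed.

End period_measure_theory.
Arguments period_mu {R}.

Lemma measurable_fun_rsum d (T : measurableType d) (R : realType) (D : set T)
    (I : Type) (s : seq I) (P : pred I) (h : I -> T -> R) :
  (forall i, P i -> measurable_fun D (h i)) ->
  measurable_fun D (fun x => \sum_(i <- s | P i) h i x).
Proof.
move=> mh; elim: s => [|i s IH].
  rewrite (_ : (fun _ => _) = cst 0); first exact: measurable_cst.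
  by apply/funext => x; rewrite big_nil.
rewrite (_ : (fun _ => _) = fun x =>
  (if P i then h i x else 0) + \sum_(j <- s | P j) h j x); last first.
  by apply/funext => x; rewrite big_cons; case: ifP; rewrite ?add0r.
apply: measurable_funD => //; case: (boolP (P i)) => Pi; first exact: mh.
exact: measurable_cst.
Qed.

Lemma ae_impl d (T : measurableType d) (R : realType)
    (mu : {measure set T -> \bar R}) (Q1 Q2 : T -> Prop) :
  (forall x, Q1 x -> Q2 x) ->
  {ae mu, forall x, Q1 x} -> {ae mu, forall x, Q2 x}.
Proof. by move=> h; apply: filterS. Qed.

Lemma ae_impl2 d (T : measurableType d) (R : realType)
    (mu : {measure set T -> \bar R}) (Q1 Q2 Q3 : T -> Prop) :
  (forall x, Q1 x -> Q2 x -> Q3 x) ->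
  {ae mu, forall x, Q1 x} -> {ae mu, forall x, Q2 x} ->
  {ae mu, forall x, Q3 x}.
Proof. by move=> h; apply: filterS2. Qed.

(** * Trigonometric polynomials and the square wave *)

Section trigonometry.
Variable R : realType.
Implicit Types (x y c : R) (n j k : nat).

(** Multiplied by [2 * cos (al / 2)], where [al] is the angle between
    consecutive terms, the sum telescopes, and its two end terms agree by
    periodicity. The factor is nonzero because [al < pi], that is [j < n].
    The phase [d] makes the sine a special case. *)
Lemma sum_alternating_cos n j x d : (j < n)%N ->
  \sum_(0 <= k < n.*2) (-1) ^+ k * cos (j%:R * (x + k%:R * (pi / n%:R)) + d)
    = 0 :> R.
Proof.
move=> jn; have n0 : n%:R != 0 :> R by rewrite pnatr_eq0 -lt0n (leq_trans _ jn).
pose al : R := j%:R * (pi / n%:R).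
have cos_half : 0 < cos (al / 2).
  have j_ge0 : 0 <= j%:R :> R by [].
  have jltn : j%:R < n%:R :> R by rewrite ltr_nat.
  have n_gt0 : 0 < n%:R :> R by rewrite lt_neqAle eq_sym n0/=.
  have al_ge0 : 0 <= al by rewrite mulr_ge0// divr_ge0// ?pi_ge0// ltW.
  have al_lt : al < pi.
    by rewrite /al mulrCA gtr_pMr ?pi_gt0// ltr_pdivrMr// mul1r.
  by apply: cos_gt0_pihalf; have := pi_gt0 R; move=> ?; apply/andP; split; lra.
pose u k : R := (-1) ^+ k * cos (j%:R * x + d + k%:R * al - al / 2).
suff : 2 * cos (al / 2) * \sum_(0 <= k < n.*2)
    (-1) ^+ k * cos (j%:R * (x + k%:R * (pi / n%:R)) + d) = 0.
  by move/eqP; rewrite !mulf_eq0 (gt_eqF cos_half) pnatr_eq0/= => /eqP.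
rewrite big_distrr/=.
transitivity (\sum_(0 <= k < n.*2) - (u k.+1 - u k)).
  apply: eq_bigr => k _; rewrite /u exprS.
  set y := j%:R * (x + k%:R * (pi / n%:R)) + d.
  have -> : j%:R * x + d + k%:R * al - al / 2 = y - al / 2.
    by rewrite /y /al; ring.
  have -> : j%:R * x + d + k.+1%:R * al - al / 2 = y + al / 2.
    by rewrite /y /al -(natr1 k); field.
  by rewrite (cosD y) (cosB y); ring.
rewrite sumrN telescope_sumr//; apply/eqP; rewrite oppr_eq0 subr_eq0; apply/eqP.
rewrite /u expr0 -mul2n exprM sqrrN expr1n expr1n mul0r addr0 !mul1r.
have -> : j%:R * x + d + (2 * n)%:R * al - al / 2
    = (j%:R * x + d - al / 2) + (pi *+ 2) *+ j.
  by rewrite /al natrM -[_ *+ j]mulr_natl -[pi *+ 2]mulr_natl; field.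
by rewrite (periodicn (@cosD2pi R)).
Qed.

(** Polynomials of order less than [n] are thus invisible to anything that
    changes sign under a translation by [pi / n]; the orthogonality relation and
    both lower bounds rest on this. *)
Lemma sum_alternating_trigpoly n (T : R -> R) x : (0 < n)%N -> trigpoly n T ->
  \sum_(0 <= k < n.*2) (-1) ^+ k * T (x + k%:R * (pi / n%:R)) = 0.
Proof.
move=> n0 [a [b ->]].
under eq_bigr do rewrite mulrDr mulr_sumr.
rewrite big_split/= exchange_big/=.
have sgn0 : \sum_(0 <= k < n.*2) (-1) ^+ k = 0 :> R.
  rewrite -[RHS](@sum_alternating_cos n 0 0 0 n0); apply: eq_bigr => k _.
  by rewrite mul0r addr0 cos0 mulr1.
rewrite -mulr_suml sgn0 mul0r add0r.
rewrite big_nat_cond big1// => j /andP[/andP[_ jn] _].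
have hc := @sum_alternating_cos n j x 0 jn.
have hs := @sum_alternating_cos n j x (- (pi / 2)) jn.
transitivity (a j * 0 + b j * 0); last by rewrite !mulr0 addr0.
apply: etrans (congr2 (fun u v => a j * u + b j * v) hc hs).
rewrite !mulr_sumr -big_split/=; apply: eq_bigr => k _.
by rewrite addr0 cosBpihalf; ring.
Qed.

Lemma trigpoly_periodic n (T : R -> R) : trigpoly n T -> periodic T (2 * pi).
Proof.
move=> [a [b ->]] x; congr (_ + _); apply: eq_bigr => j _.
have -> : j%:R * (x + 2 * pi) = j%:R * x + (pi *+ 2) *+ j.
  by rewrite -[_ *+ j]mulr_natl -[pi *+ 2]mulr_natl; ring.
by rewrite (periodicn (@cosD2pi R)) (periodicn (@sinD2pi R)).
Qed.

Lemma measurable_sinM c : measurable_fun setT (fun x : R => sin (c * x)).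
Proof.
apply: (measurableT_comp (f := @sin R)); last exact: measurable_funM.
by apply: continuous_measurable_fun; exact: continuous_sin.
Qed.

Lemma measurable_cosM c : measurable_fun setT (fun x : R => cos (c * x)).
Proof.
apply: (measurableT_comp (f := @cos R)); last exact: measurable_funM.
by apply: continuous_measurable_fun; exact: continuous_cos.
Qed.

Lemma measurable_trigpoly n (T : R -> R) : trigpoly n T -> measurable_fun setT T.
Proof.
move=> [a [b ->]]; apply: measurable_funD => //.
apply: measurable_fun_rsum => j _.
apply: measurable_funD; apply: measurable_funM => //.
  exact: measurable_cosM.
exact: measurable_sinM.
Qed.

Lemma trigpoly_bounded n (T : R -> R) : trigpoly n T ->
  exists2 C, 0 <= C & forall x, `|T x| <= C.
Proof.
move=> [a [b ->]]; exists (`|a 0%N / 2| + \sum_(1 <= k < n) (`|a k| + `|b k|)).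
  by rewrite addr_ge0// sumr_ge0// => k _; rewrite addr_ge0.
move=> x; apply: (le_trans (ler_normD _ _)); rewrite lerD2l.
apply: (le_trans (ler_norm_sum _ _ _)); apply: ler_sum => k _.
apply: (le_trans (ler_normD _ _)); rewrite !normrM lerD// ler_piMr//.
  by rewrite ler_norml cos_geN1 cos_le1.
by rewrite ler_norml sin_geN1 sin_le1.
Qed.

Lemma phi_n_antiperiodic n x : (0 < n)%N ->
  phi_n n (x + pi / n%:R) = - phi_n n x.
Proof.
move=> n0; rewrite /phi_n -sgrN -sinDpi; congr (Num.sg (sin _)).
by field; rewrite pnatr_eq0 -lt0n.
Qed.

Lemma antiperiodic_translate (h : R -> R) L k x :
  (forall y, h (y + L) = - h y) -> h (x + k%:R * L) = (-1) ^+ k * h x.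
Proof.
move=> hL; elim: k x => [|k IH] x; first by rewrite mul0r addr0 mul1r.
by rewrite -natr1 mulrDl mul1r addrA hL IH exprS mulN1r mulNr.
Qed.

Lemma antiperiodic_periodic (h : R -> R) n : (0 < n)%N ->
  (forall y, h (y + pi / n%:R) = - h y) -> periodic h (2 * pi).
Proof.
move=> n0 hL x; have -> : 2 * pi = (2 * n)%:R * (pi / n%:R) :> R.
  by rewrite natrM; field; rewrite pnatr_eq0 -lt0n.
by rewrite antiperiodic_translate// exprM sqrrN !expr1n mul1r.
Qed.

Lemma phi_n_periodic n : (0 < n)%N -> periodic (@phi_n R n) (2 * pi).
Proof.
by move=> n0; apply: (antiperiodic_periodic n0) => y; exact: phi_n_antiperiodic.
Qed.

Lemma phi_nN n x : phi_n n (- x) = - phi_n n x.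
Proof. by rewrite /phi_n mulrN sinN sgrN. Qed.

Lemma phi_n_le1 n x : `|phi_n n x| <= 1.
Proof. by rewrite /phi_n normr_sg; case: (_ != 0). Qed.

Lemma measurable_phi_n n : measurable_fun setT (@phi_n R n).
Proof.
rewrite (_ : phi_n n = fun x =>
  if 0 < sin (n%:R * x) then 1 else if sin (n%:R * x) < 0 then -1 else 0 :> R).
  have ms := measurable_sinM n%:R.
  apply: measurable_fun_if => //; first exact: measurable_fun_ltr.
  apply: measurable_funTS; apply: measurable_fun_if => //.
  exact: measurable_fun_ltr.
by apply/funext => x; rewrite /phi_n; case: sgrP.
Qed.

(** Reduce modulo [pi], which preserves [|sin|], to the interval where [sin] is
    positive. *)
Lemma sin_eq0_int x : sin x = 0 -> exists k : int, x = k%:~R * pi.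
Proof.
move=> sx0; exists (Num.floor (x / pi)); set k := Num.floor _.
have abs_per y : `|sin (y + pi)| = `|sin y :> R|.
  by rewrite (sinDpi y) normrN.
have := periodicz abs_per (- k) x; rewrite sx0 normr0 => /eqP.
rewrite normr_eq0 => /eqP; rewrite mulrNz mulNr => s0.
have /andP[] := mem_rg1_floor (x / pi); rewrite -/k.
rewrite ler_pdivlMr ?pi_gt0// ltr_pdivrMr ?pi_gt0// mulrDl mul1r.
rewrite le_eqVlt => /predU1P[//|kx xk].
suff : 0 < sin (x - k%:~R * pi) by rewrite s0 ltxx.
by apply: sin_gt0_pi; apply/andP; split; lra.
Qed.

(** The discontinuities of [phi_n] are zeros of [sin (n * x)], a countable
    set. *)
Lemma ae_sin_neq0 n c : (0 < n)%N ->
  {ae @lebesgue_measure R, forall t, sin (n%:R * (c - t)) != 0}.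
Proof.
move=> n0; pose z (k : int) : R := c - k%:~R * pi / n%:R.
have cz : countable (range z).
  by apply: card_le_trans (card_image_le z setT) _; exact: countableP.
exists (range z); split.
- exact: countable_measurable.
- exact: countable_lebesgue_measure0.
- move=> t /negP; rewrite negbK => /eqP/sin_eq0_int[k kE]; exists k => //.
  have n0' : n%:R != 0 :> R by rewrite pnatr_eq0 -lt0n.
  by rewrite /z -kE; field.
Qed.

Lemma continuous_phi_n_at n y : sin (n%:R * y) != 0 ->
  {for y, continuous (@phi_n R n)}.
Proof.
move=> sy0.
have cs : (fun x : R => sin (n%:R * x)) x @[x --> y] --> sin (n%:R * y).
  apply: (@continuous_comp _ _ _ (fun x : R => n%:R * x) sin).
    by apply: cvgMr; exact: cvg_id.
  exact: continuous_sin.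
have [s0|s0|s0] := ltrgtP (sin (n%:R * y)) 0.
- apply: cvg_near_cst; near=> x; apply/eqP.
  rewrite /phi_n (ltr0_sg s0); apply/eqP/ltr0_sg.
  by near: x; exact: (cvgr_lt _ cs).
- apply: cvg_near_cst; near=> x; apply/eqP.
  rewrite /phi_n (gtr0_sg s0); apply/eqP/gtr0_sg.
  by near: x; exact: (cvgr_gt _ cs).
- by move: sy0; rewrite s0 eqxx.
Unshelve. all: by end_near. Qed.

End trigonometry.

(** * Convolution of the kernel with the square wave *)

Section integral_lemmas.
Context d (T : measurableType d) (R : realType).
Variables (mu : {measure set T -> \bar R}) (D : set T).
Hypothesis mD : measurable D.

Lemma integrable_mul_bounded (h g : T -> R) C :
  mu.-integrable D (EFin \o h) -> measurable_fun D g ->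
  (forall x, D x -> `|g x| <= C) ->
  mu.-integrable D (fun x => (h x * g x)%:E).
Proof.
move=> ih mg gC; apply: (@integrableMl _ _ _ mu D mD (EFin \o h) g) => //.
exists C; split; first exact: num_real.
by move=> M CM x Dx; exact: le_trans (gC x Dx) (ltW CM).
Qed.

Lemma Rintegral_eq0 (f : T -> R) : (forall x, D x -> f x = 0) ->
  \int[mu]_(x in D) f x = 0.
Proof.
by move=> f0; rewrite /Rintegral integral0_eq// => x Dx; rewrite f0.
Qed.

Lemma Rintegral_sum (I : Type) (s : seq I) (h : I -> T -> R) :
  (forall i, mu.-integrable D (EFin \o h i)) ->
  \int[mu]_(x in D) (\sum_(i <- s) h i x) =
  \sum_(i <- s) \int[mu]_(x in D) h i x.
Proof.
move=> ih; elim: s => [|i s IH].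
  by rewrite big_nil Rintegral_eq0// => x _; rewrite big_nil.
rewrite big_cons -IH -RintegralD//.
  by apply: eq_Rintegral => x _; rewrite big_cons.
rewrite (_ : _ \o _ = fun x => \sum_(j <- s) (h j x)%:E)%E; last first.
  by apply/funext => x /=; rewrite sumEFin.
by apply: integrable_sum => // i' _; exact: ih.
Qed.

End integral_lemmas.

Section convolution_with_phi.
Variable R : realType.
Notation mu := (@lebesgue_measure R).
Notation P := (period_itv R).
Notation mP := (measurable_period_itv R).
Implicit Types (K T : R -> R) (n : nat).

Lemma Lp1P K : Lp 1%E K ->
  [/\ measurable_fun setT K, periodic K (2 * pi) &
      mu.-integrable P (EFin \o K)].
Proof.
move=> [Kper]; rewrite inE => /andP[]; rewrite !inE/= => mK.
rewrite /finite_norm Lnorm1 => Koo; split => //.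
apply/integrable_period_mu; first exact/measurable_EFinP.
by apply/integrableP; split => //; exact/measurable_EFinP.
Qed.

Lemma Rintegral_period_shift (f : R -> R) c : measurable_fun setT f ->
  periodic f (2 * pi) ->
  \int[mu]_(x in P) f (c + x) = \int[mu]_(x in P) f x.
Proof.
move=> mf fL; rewrite /Rintegral; congr fine.
apply: (@integral_period_shift R (EFin \o f)) => [|x /=].
  exact/measurable_EFinP.
by rewrite fL.
Qed.

Lemma Rintegral_period_reflect (f : R -> R) c : measurable_fun setT f ->
  periodic f (2 * pi) ->
  \int[mu]_(x in P) f (c - x) = \int[mu]_(x in P) f x.
Proof.
move=> mf fL; rewrite /Rintegral; congr fine.
apply: (@integral_period_reflect R (EFin \o f)) => [|x /=].
  exact/measurable_EFinP.
by rewrite fL.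
Qed.

Lemma trigpoly_integrable n T : trigpoly n T -> mu.-integrable P (EFin \o T).
Proof.
move=> tT; have [C _ TC] := trigpoly_bounded tT.
apply: measurable_bounded_integrable.
- exact: mP.
- exact: lebesgue_measure_period_lty.
- exact: measurable_funTS (measurable_trigpoly tT).
- exists C; split; first exact: num_real.
  by move=> M CM x _; exact: le_trans (TC x) (ltW CM).
Qed.

(** Translating by [k * pi / n] multiplies [psi] by [(-1) ^ k] and leaves the
    integral unchanged; summing over the [2n] translates gives [2n] times the
    integral on one side and [0] on the other. *)
Lemma trigpoly_orthogonal n T (psi : R -> R) (C : R) : (0 < n)%N -> trigpoly n T ->
  measurable_fun setT psi -> (forall x, `|psi x| <= C) ->
  (forall x, psi (x + pi / n%:R) = - psi x) ->
  \int[mu]_(x in P) (T x * psi x) = 0.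
Proof.
move=> n0 tT mpsi psiC psiA.
have mT := measurable_trigpoly tT.
have TL := trigpoly_periodic tT.
have psiL := antiperiodic_periodic n0 psiA.
pose c k : R := k%:R * (pi / n%:R).
have shiftE k : \int[mu]_(x in P) ((-1) ^+ k * T (x + c k) * psi x) =
    \int[mu]_(x in P) (T x * psi x).
  rewrite -(@Rintegral_period_shift (fun x => T x * psi x) (c k)).
  - apply: eq_Rintegral => x _ /=.
    by rewrite [c k + x]addrC (antiperiodic_translate k x psiA); ring.
  - exact: measurable_funM.
  - by move=> x; rewrite TL psiL.
have mTc k : measurable_fun setT (fun x : R => (-1) ^+ k * T (x + c k)).
  apply: measurable_funM => //; apply: measurableT_comp mT _.
  exact: measurable_funD.
have [B _ TB] := trigpoly_bounded tT.
have ik k : mu.-integrable P (EFin \o (fun x : R => (-1) ^+ k * T (x + c k) * psi x)).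
  apply: (@integrable_mul_bounded _ _ _ mu P mP _ _ C).
  - apply: measurable_bounded_integrable.
    + exact: mP.
    + exact: lebesgue_measure_period_lty.
    + exact: measurable_funTS (mTc k).
    + exists B; split; first exact: num_real.
      move=> M CM x _ /=; rewrite normrM normrX normrN1 expr1n mul1r.
      exact: le_trans (TB _) (ltW CM).
  - exact: measurable_funTS.
  - by move=> x _.
have : \sum_(0 <= k < n.*2) \int[mu]_(x in P) (T x * psi x) = 0.
  under eq_bigr => k _ do rewrite -(shiftE k).
  rewrite -Rintegral_sum//; last exact: mP.
  rewrite Rintegral_eq0// => x _.
  by rewrite -mulr_suml sum_alternating_trigpoly// mul0r.
rewrite sumr_const_nat subn0 => /eqP.
by rewrite mulrn_eq0 double_eq0 (gtn_eqF n0) => /eqP.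
Qed.

Section fixed_kernel.
Variables (n : nat) (K : R -> R).
Hypotheses (n0 : (0 < n)%N) (mK : measurable_fun setT K)
  (iK : mu.-integrable P (EFin \o K)).

Lemma measurable_phi_reflect c : measurable_fun setT (fun t : R => phi_n n (c - t)).
Proof.
apply: (measurableT_comp (f := @phi_n R n) (g := fun t : R => c - t)).
  exact: measurable_phi_n.
exact: measurable_funB.
Qed.

Lemma phi_reflect_antiperiodic c x :
  phi_n n (c - (x + pi / n%:R)) = - phi_n n (c - x) :> R.
Proof.
have -> : c - x = c - (x + pi / n%:R) + pi / n%:R by ring.
by rewrite phi_n_antiperiodic// opprK.
Qed.

Lemma convolution_phi_sub_trigpoly T x : trigpoly n T ->
  convolution K (phi_n n) x =
  \int[mu]_(t in P) ((K t - T t) * phi_n n (x - t)).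
Proof.
move=> tT; rewrite /convolution.
transitivity (\int[mu]_(t in P) (K t * phi_n n (x - t)) -
              \int[mu]_(t in P) (T t * phi_n n (x - t))).
  rewrite (@trigpoly_orthogonal n T _ 1)// ?subr0//.
  - exact: measurable_phi_reflect.
  - by move=> t; exact: phi_n_le1.
  - by move=> t; exact: phi_reflect_antiperiodic.
have iphi h : mu.-integrable P (EFin \o h) ->
    mu.-integrable P (EFin \o (fun t => h t * phi_n n (x - t))).
  move=> ih; apply: (@integrable_mul_bounded _ _ _ mu P mP _ _ 1) => //.
    exact: measurable_funTS (measurable_phi_reflect x).
  by move=> t _; exact: phi_n_le1.
rewrite -RintegralB//.
- by apply: eq_Rintegral => t _; rewrite mulrBl.
- exact: mP.
- exact: iphi.
- by apply: iphi; exact: trigpoly_integrable tT.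
Qed.

(** The sign condition says that [(K - T) (t)] times [phi_n (t - theta)] is
    its own absolute value, and [phi_n] is odd and of modulus [1] outside a null
    set. *)
Lemma convolution_phi_at_theta T theta : trigpoly n T ->
  {ae mu, forall x, 0 <= (K x - T x) * phi_n n (x - theta)} ->
  (\int[mu]_(t in P) `|K t - T t|%:E)%E =
  `|convolution K (phi_n n) theta|%:E.
Proof.
move=> tT sgnD.
have mT := measurable_trigpoly tT.
have iD : mu.-integrable P (EFin \o (fun t => K t - T t)).
  rewrite (_ : _ \o _ = (EFin \o K) \- (EFin \o T))%E//.
  by apply: integrableB => //; [exact: mP|exact: trigpoly_integrable tT].
have mD : measurable_fun setT (fun t : R => K t - T t) by exact: measurable_funB.
rewrite (convolution_phi_sub_trigpoly theta tT).
have -> : \int[mu]_(t in P) ((K t - T t) * phi_n n (theta - t)) =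
    \int[mu]_(t in P) (- `|K t - T t|).
  rewrite /Rintegral; congr fine; apply: ae_eq_integral.
  - exact: mP.
  - apply: measurable_funTS; apply/measurable_EFinP.
    by apply: measurable_funM => //; exact: measurable_phi_reflect.
  - apply: measurable_funTS; apply/measurable_EFinP.
    by apply: measurableT_comp => //; exact: measurableT_comp.
  - apply: ae_impl2 sgnD (ae_sin_neq0 theta n0) => t /= Dphi s0 _; congr (_%:E).
    have tE : theta - t = - (t - theta) by rewrite opprB.
    move: s0 Dphi; rewrite tE mulrN sinN oppr_eq0 phi_nN mulrN => s0 Dphi.
    rewrite -[in RHS](mulr1 `|_|) -[in RHS](_ : `|phi_n n (t - theta)| = 1).
      by rewrite -normrM ger0_norm.
    by rewrite /phi_n normr_sg s0.
have iabsD : mu.-integrable P (EFin \o (fun t => `|K t - T t|)).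
  exact: (integrable_abse iD).
have -> : \int[mu]_(t in P) (- `|K t - T t|) = - \int[mu]_(t in P) `|K t - T t|.
  rewrite -[RHS]mulN1r -RintegralZl//; last exact: mP.
  by apply: eq_Rintegral => t _; rewrite mulN1r.
rewrite normrN ger0_norm; last by apply: Rintegral_ge0 => t _.
by rewrite /Rintegral fineK//; apply: integrable_fin_num => //; exact: mP.
Qed.

Lemma convolution_phi_translate k x :
  convolution K (phi_n n) (x + k%:R * (pi / n%:R)) =
  (-1) ^+ k * convolution K (phi_n n) x.
Proof.
rewrite /convolution -RintegralZl.
- apply: eq_Rintegral => t _.
  rewrite (_ : x + _ - t = x - t + k%:R * (pi / n%:R)); last by ring.
  rewrite (antiperiodic_translate k (x - t) (fun y => phi_n_antiperiodic y n0)).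
  by rewrite mulrCA.
- exact: mP.
- apply: (@integrable_mul_bounded _ _ _ mu P mP _ _ 1) => //.
    exact: measurable_funTS (measurable_phi_reflect x).
  by move=> t _; exact: phi_n_le1.
Qed.

Lemma periodic_convolution_phi : periodic (convolution K (phi_n n)) (2 * pi).
Proof.
move=> x; have -> : 2 * pi = (2 * n)%:R * (pi / n%:R) :> R.
  by rewrite natrM; field; rewrite pnatr_eq0 -lt0n.
by rewrite convolution_phi_translate exprM sqrrN !expr1n mul1r.
Qed.

(** For fixed [a], the integrand tends to its value at [a] for almost every
    [t], with [|K|] as a dominating function. The exceptional set of [t] moves
    with [a], so continuity is obtained at each point by sequences. *)
Lemma continuous_convolution_phi : continuous (convolution K (phi_n n)).
Proof.
move=> a; apply/(@cvg_nbhsP _ R^o) => w wa.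
apply: fine_cvg; rewrite fineK; last first.
  apply: integrable_fin_num; first exact: mP.
  apply: (@integrable_mul_bounded _ _ _ mu P mP _ _ 1) => //.
    exact: measurable_funTS (measurable_phi_reflect a).
  by move=> t _; exact: phi_n_le1.
have mKphi y : measurable_fun P (fun t => (K t * phi_n n (y - t))%:E).
  apply: measurable_funTS; apply/measurable_EFinP.
  by apply: measurable_funM => //; exact: measurable_phi_reflect.
have := @dominated_convergence _ _ R mu P mP
  (fun k t => (K t * phi_n n (w k - t))%:E) (fun t => (K t * phi_n n (a - t))%:E)
  (fun t => `|K t|%:E) (fun k => mKphi (w k)) (mKphi a).
case=> //.
- apply: ae_impl (ae_sin_neq0 a n0) => t s0 _ /=.
  apply: cvg_EFin; first by near=> k.
  apply: cvgMr.
  have c1 : (w k - t) @[k --> \oo] --> a - t by apply: cvgB => //; exact: cvg_cst.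
  exact: (cvg_comp _ _ c1 (continuous_phi_n_at s0)).
- exact: (integrable_abse iK).
- apply: aeW => k t _ /=; rewrite lee_fin normrM ler_piMr//; exact: phi_n_le1.
Unshelve. all: by end_near. Qed.

Lemma measurable_convolution_phi :
  measurable_fun setT (convolution K (phi_n n)).
Proof. by apply: continuous_measurable_fun; exact: continuous_convolution_phi. Qed.

End fixed_kernel.

(** If the bound failed at [theta], it would fail on an interval to the right
    of [theta] within the period, which has positive measure. *)
Lemma ae_le_continuous (h : R -> R) (M : \bar R) (theta : R) :
  continuous h -> 0 <= theta < 2 * pi ->
  {ae @period_mu R, forall x, (`|h x|%:E <= M)%E} -> (`|h theta|%:E <= M)%E.
Proof.
move=> hc /andP[th0 th2] [N [mN N0 hN]]; rewrite leNgt; apply/negP => Mh.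
have : \forall x \near theta, (M < `|h x|%:E)%E.
  case: M Mh hN => [M| |]// Mh _; last by near=> x; exact: ltNyr.
  have hn : `|h x| @[x --> theta] --> `|h theta| by apply: cvg_norm; exact: hc.
  by near=> x; rewrite lte_fin; near: x; apply: (cvgr_gt _ hn).
move=> /nbhs_ballP[e /= e0 be].
pose b : R := Num.min (theta + e) (2 * pi).
have thb : theta < b by rewrite lt_min th2 ltrDl e0.
have sub : `]theta, b[%classic `<=` N.
  move=> x /=; rewrite in_itv/= lt_min => /and3P[x1 x2 x3].
  apply: hN => /=; apply/negP; rewrite -ltNge; apply: be.
  by rewrite /ball/= distrC ger0_norm; lra.
have subP : `]theta, b[%classic `<=` P.
  move=> x; rewrite /period_itv/= !in_itv/= lt_min => /and3P[x1 x2 x3].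
  by apply/andP; split; lra.
have : (mu `]theta, b[ <= period_mu N)%E.
  rewrite period_muE; apply: le_measure; rewrite ?inE//.
    exact: measurableI mN mP.
  by move=> x xI; split; [exact: sub|exact: subP].
by rewrite N0 lebesgue_measure_itv/= lte_fin thb -EFinB lee_fin; lra.
Unshelve. all: by end_near. Qed.

End convolution_with_phi.

(** * Norms over a period and Fubini for convolutions *)

Section scalar_lower_bound.
Variable R : realType.
Notation mu := (@lebesgue_measure R).
Notation P := (period_itv R).
Notation mP := (measurable_period_itv R).
Implicit Types (T : R -> R) (n : nat).

Lemma normLp_infty (f : R -> \bar R) :
  normLp +oo%E f = ess_sup period_mu (abse \o f).
Proof.
by rewrite /normLp Lnorm.unlock /= ifT//; exact: period_muT_gt0.
Qed.

Lemma normLp1 (f : R -> \bar R) : normLp 1%E f = (\int[period_mu]_x `|f x|)%E.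
Proof. by rewrite /normLp Lnorm1. Qed.

Lemma normLp_ge0 (p : \bar R) (f : R -> \bar R) : (0 <= normLp p f)%E.
Proof. exact: Lnorm_ge0. Qed.

Lemma normLp1E (f : R -> R) : measurable_fun setT f ->
  normLp 1%E (EFin \o f) = (\int[mu]_(x in P) `|f x|%:E)%E.
Proof.
move=> mf; rewrite normLp1 integral_period_mu//; apply/measurable_EFinP.
exact: measurableT_comp.
Qed.

Lemma ae_normLp_infty (f : R -> \bar R) :
  {ae period_mu, forall x, (`|f x| <= normLp +oo%E f)%E}.
Proof. by rewrite normLp_infty; exact: (ess_sup_ge period_mu (abse \o f)). Qed.

Lemma normLp_infty_le (f : R -> \bar R) (M : \bar R) :
  {ae period_mu, forall x, (`|f x| <= M)%E} -> (normLp +oo%E f <= M)%E.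
Proof. by move=> fM; rewrite normLp_infty; apply/ess_supP. Qed.

Section kernel_fubini.
Variables (K : R -> R) (B : R * R -> R) (C : R).
Hypotheses (mK : measurable_fun setT K) (iK : mu.-integrable P (EFin \o K)).
Hypotheses (mB : measurable_fun setT B) (BC : forall z, `|B z| <= C).

Let f (z : measurableTypeR R * measurableTypeR R) : \bar R :=
  (K z.2 * B z)%:E.

Let mf : measurable_fun setT f.
Proof.
apply/measurable_EFinP; apply: measurable_funM => //.
by apply: measurableT_comp mK _; exact: measurable_snd.
Qed.

Let mBx x : measurable_fun setT (fun t : R => B (x, t)).
Proof. exact: measurable_fun_pair2. Qed.

Let mBt t : measurable_fun setT (fun x : R => B (x, t)).
Proof. exact: measurable_fun_pair1. Qed.

Let iBt t : mu.-integrable P (fun x => (B (x, t))%:E).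
Proof.
apply: measurable_bounded_integrable.
- exact: mP.
- exact: lebesgue_measure_period_lty.
- exact: measurable_funTS (mBt t).
- exists C; split; first exact: num_real.
  by move=> M CM x _; exact: le_trans (BC _) (ltW CM).
Qed.

Lemma kernel_integrable_section x :
  mu.-integrable P (fun t => (K t * B (x, t))%:E).
Proof.
apply: (@integrable_mul_bounded _ _ _ mu P mP _ (fun t => B (x, t)) C) => //.
exact: measurable_funTS (mBx x).
Qed.

Let mKB x : measurable_fun setT (fun t : R => (K t * B (x, t))%:E).
Proof. by apply/measurable_EFinP; apply: measurable_funM. Qed.

Lemma kernel_integrable_prod : (period_mu \x period_mu)%E.-integrable setT f.
Proof.
apply/integrable12ltyP => //.
have [ik1 ik2] := integrableP _ _ _ iK.
have C0 : 0 <= C by apply: le_trans (BC (0, 0)).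
apply: (@le_lt_trans _ _ (\int[period_mu]_x (\int[mu]_(t in P) (`|K t| * C)%:E))%E).
  apply: ge0_le_integral => //.
  - by move=> x _; exact: integral_ge0.
  - have := @measurable_fun_fubini_tonelli_F _ _ _ _ R period_mu (abse \o f).
    by apply; [exact: measurableT_comp|move=> z; exact: abse_ge0].
  - move=> x _; rewrite ge0_integral_period_mu//; last by apply: measurableT_comp (mKB x).
    apply: ge0_le_integral; first exact: mP.
    + by [].
    + by apply: measurable_funTS; apply: measurableT_comp (mKB x).
    + apply: measurable_funTS; apply/measurable_EFinP.
      by apply: measurable_funM => //; exact: measurableT_comp.
    + by move=> t _; rewrite lee_fin normrM ler_wpM2l.
have iKC : mu.-integrable P (fun t => (`|K t| * C)%:E).
  apply: (@integrable_mul_bounded _ _ _ mu P mP (fun t => `|K t|) (fun=> C) `|C|).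
  - exact: (integrable_abse iK).
  - exact: measurable_cst.
  - by [].
have fC := integrable_fin_num mP iKC.
rewrite (integral_cst period_mu measurableT (\int[mu]_(t in P) (`|K t| * C)%:E)%E).
by rewrite ltey_eq fin_numM//= fin_num_measure.
Qed.

Let FE : fubini_F period_mu f = EFin \o (fun x => \int[mu]_(t in P) (K t * B (x, t))).
Proof.
apply/funext => x; rewrite /fubini_F /= (integral_period_mu (mKB x)) /Rintegral fineK//.
by apply: integrable_fin_num; [exact: mP|exact: kernel_integrable_section].
Qed.

Let GE : fubini_G period_mu f = EFin \o (fun t => K t * \int[mu]_(x in P) B (x, t)).
Proof.
apply/funext => t; rewrite /fubini_G /f/= integral_period_mu; last first.
  apply/measurable_EFinP.
  by apply: measurable_funM; [exact: measurable_cst|exact: mBt].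
rewrite -RintegralZl//; [|exact: mP|exact: iBt].
rewrite /Rintegral fineK//; apply: integrable_fin_num; first exact: mP.
have := @integrableZl _ _ _ mu P mP (K t) _ (iBt t).
by apply: eq_integrable => //; exact: mP.
Qed.

Lemma measurable_kernel_integral :
  measurable_fun setT (fun x : R => \int[mu]_(t in P) (K t * B (x, t))).
Proof.
apply/measurable_EFinP; rewrite -FE.
exact: measurable_fubini_F kernel_integrable_prod.
Qed.

Lemma integrable_kernel_integral :
  mu.-integrable P (fun x => (\int[mu]_(t in P) (K t * B (x, t)))%:E).
Proof.
apply/integrable_period_mu; first by apply/measurable_EFinP; exact: measurable_kernel_integral.
by have := integrable_fubini_F kernel_integrable_prod; rewrite FE.
Qed.

(** Fubini in the form used for convolutions: an integrable kernel depending
    on one variable, times a bounded function of both. *)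
Lemma kernel_Fubini :
  \int[mu]_(x in P) \int[mu]_(t in P) (K t * B (x, t)) =
  \int[mu]_(t in P) (K t * \int[mu]_(x in P) B (x, t)).
Proof.
have /(congr1 fine) := Fubini kernel_integrable_prod.
rewrite -[X in fine X = _]/(\int[period_mu]_x fubini_F period_mu f x)%E.
rewrite -[X in _ = fine X]/(\int[period_mu]_x fubini_G period_mu f x)%E FE GE.
rewrite integral_period_mu; last by apply/measurable_EFinP; exact: measurable_kernel_integral.
rewrite integral_period_mu// -GE; exact: measurable_fubini_G kernel_integrable_prod.
Qed.

End kernel_fubini.
End scalar_lower_bound.

(** * Lower bound for the scalar class: uniform norm *)

Section scalar_class.
Variable R : realType.
Notation mu := (@lebesgue_measure R).
Notation P := (period_itv R).
Notation mP := (measurable_period_itv R).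
Variables (n : nat) (K : R -> R).
Hypotheses (n0 : (0 < n)%N) (mK : measurable_fun setT K)
  (iK : mu.-integrable P (EFin \o K)).
Local Notation f := (convolution K (phi_n n)).

Lemma LpP (p : \bar R) (g : R -> R) : measurable_fun setT g ->
  periodic g (2 * pi) -> (normLp p (EFin \o g) < +oo)%E -> Lp p g.
Proof.
move=> mg gL gfin; split => //; rewrite inE; apply/andP; rewrite !inE/=.
by split.
Qed.

Lemma F_ballP (p : \bar R) (g : R -> R) : measurable_fun setT g ->
  periodic g (2 * pi) -> (normLp p (EFin \o g) <= 1)%E -> F_ball p g.
Proof.
move=> mg gL g1; split => //; apply: LpP => //.
by rewrite (le_lt_trans g1)// ltry.
Qed.

Lemma best_approx_ge (H : set (R -> R)) (p M : \bar R) (phi : R -> R) :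
  F_ball p phi ->
  (forall T, H T -> (M <= normLp p (EFin \o (convolution K phi \- T)%R))%E) ->
  (M <= best_approx (conv_class K p) H p)%E.
Proof.
move=> Fphi HM; apply: le_ereal_sup_tmp.
exists (ereal_inf [set normLp p (EFin \o (convolution K phi \- T)%R) | T in H]).
  by exists (convolution K phi) => //; exists phi.
by apply: le_ereal_inf_tmp => _ [T HT <-]; exact: HM.
Qed.

(** The alternating sum over the [2n] equidistant translates kills [T] and
    multiplies [f] by [2n], so [f] is almost everywhere bounded by any essential
    bound of [f - T]. *)
Lemma best_approx_infty_ge :
  (normLp +oo%E (EFin \o f) <= best_approx (conv_class K +oo%E) (trigpoly n) +oo%E)%E.
Proof.
apply: (@best_approx_ge _ _ _ (phi_n n)).
  apply: F_ballP; [exact: measurable_phi_n|exact: phi_n_periodic|].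
  apply: normLp_infty_le; apply: aeW => x /=; rewrite lee_fin; exact: phi_n_le1.
move=> T tT; set h := f \- T; set M := (X in (_ <= X)%E).
have mf := measurable_convolution_phi n0 mK iK.
have fL := periodic_convolution_phi n0 iK.
have mT := measurable_trigpoly tT; have TL := trigpoly_periodic tT.
have mh : measurable_fun setT h by exact: measurable_funB.
have hM : {ae @period_mu R, forall x, (`|(h x)%:E| <= M)%E} by exact: ae_normLp_infty.
have {hM}hM (k : nat) :
    {ae @period_mu R, forall x, (`|(h (k%:R * (pi / n%:R) + x)%R)%:E| <= M)%E}.
  apply: (@ae_period_shift R (fun x => (`|(h x)%:E| <= M)%E)) hM.
  - rewrite (_ : [set x | _] = [set: R] `&` [set x | (M < `|(h x)%:E|)%E]); last first.
      by rewrite setTI; apply/seteqP; split => x /=; rewrite ltNge => /negP.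
    apply: emeasurable_fun_o_infty => //; apply: measurableT_comp => //.
    exact/measurable_EFinP.
  - by move=> x; rewrite /h/= fL TL.
apply: normLp_infty_le.
have := @ae_foralln _ _ _ (@period_mu R) _ hM.
apply: ae_impl => x hx /=.
have sum_h : f x * n.*2%:R =
    \sum_(0 <= k < n.*2) (-1) ^+ k * h (k%:R * (pi / n%:R) + x).
  rewrite (eq_bigr (fun k => f x - (-1) ^+ k * T (x + k%:R * (pi / n%:R)))).
    rewrite sumrB sum_alternating_trigpoly// subr0 sumr_const_nat subn0.
    by rewrite mulr_natr.
  move=> k _; rewrite /h/=.
  have -> : k%:R * (pi / n%:R) + x = x + k%:R * (pi / n%:R) by rewrite addrC.
  rewrite (convolution_phi_translate n0 iK) mulrBr [_ * (_ * f x)]mulrA.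
  by rewrite -exprD addnn -mul2n exprM sqrrN !expr1n mul1r.
case EM : M hx => [r| |] hx; last 2 first.
- by rewrite leey.
- by have := hx 0%N; rewrite leeNy_eq.
rewrite lee_fin; have n2 : 0 < n.*2%:R :> R by rewrite ltr0n double_gt0.
rewrite -(ler_pM2r n2) -[X in X <= _](_ : `|f x * n.*2%:R| = _); last first.
  by rewrite normrM (gtr0_norm n2).
rewrite sum_h.
apply: (le_trans (ler_norm_sum _ _ _)).
apply: (@le_trans _ _ (\sum_(0 <= k < n.*2) r)).
  apply: ler_sum => k _; rewrite normrM normrX normrN1 expr1n mul1r -lee_fin.
  exact: hx.
by rewrite sumr_const_nat subn0 mulr_natr.
Qed.

End scalar_class.

(** * Lower bound for the scalar class: mean norm *)

Section scalar_class_one.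
Variable R : realType.
Notation mu := (@lebesgue_measure R).
Notation P := (period_itv R).
Notation mP := (measurable_period_itv R).
Variables (n : nat) (K : R -> R).
Hypotheses (n0 : (0 < n)%N) (mK : measurable_fun setT K)
  (iK : mu.-integrable P (EFin \o K)).
Local Notation f := (convolution K (phi_n n)).

Let psi (x : R) : R := phi_n n (- x).

Let mpsi : measurable_fun setT psi.
Proof.
rewrite (_ : psi = fun x => phi_n n (0 - x)); first exact: measurable_phi_reflect.
by apply/funext => x; rewrite sub0r.
Qed.

Let psiA x : psi (x + pi / n%:R) = - psi x.
Proof. by rewrite /psi -[- (x + _)]sub0r phi_reflect_antiperiodic// sub0r. Qed.

Let psiL : periodic psi (2 * pi).
Proof. exact: antiperiodic_periodic n0 psiA. Qed.

(** Fubini, twice: testing [K * phi] against the reflection of [phi_n] amounts to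
    testing [phi] against the reflection of [K * phi_n]. *)
Lemma convolution_adjoint (phi : R -> R) (C : R) : measurable_fun setT phi ->
  periodic phi (2 * pi) -> (forall x, `|phi x| <= C) ->
  \int[mu]_(x in P) (convolution K phi x * phi_n n (- x)) =
  \int[mu]_(s in P) (phi s * f (- s)).
Proof.
move=> mphi phiL phiC; have C0 : 0 <= C by exact: le_trans (phiC 0).
pose B0 (z : R * R) := phi (z.1 - z.2).
pose B1 (z : R * R) := phi (z.1 - z.2) * psi z.1.
pose B2 (z : R * R) := phi z.1 * psi (z.1 + z.2).
have m1 : measurable_fun setT (fun z : R * R => z.1) by exact: measurable_fst.
have m2 : measurable_fun setT (fun z : R * R => z.2) by exact: measurable_snd.
have mB0 : measurable_fun setT B0.
  by apply: measurableT_comp mphi _; exact: measurable_funB.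
have mB1 : measurable_fun setT B1.
  by apply: measurable_funM => //; exact: measurableT_comp mpsi _.
have mB2 : measurable_fun setT B2.
  apply: measurable_funM; first exact: measurableT_comp mphi _.
  by apply: measurableT_comp mpsi _; exact: measurable_funD.
have B1C z : `|B1 z| <= C.
  by rewrite normrM -[leRHS]mulr1 ler_pM//; exact: phi_n_le1.
have B2C z : `|B2 z| <= C.
  by rewrite normrM -[leRHS]mulr1 ler_pM//; exact: phi_n_le1.
transitivity (\int[mu]_(x in P) \int[mu]_(t in P) (K t * B1 (x, t))).
  apply: eq_Rintegral => x _; rewrite /convolution -RintegralZr//.
  - by apply: eq_Rintegral => t _; rewrite /B1/= mulrA.
  - exact: mP.
  - exact: (kernel_integrable_section iK mB0 (fun z => phiC (z.1 - z.2)) x).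
rewrite (kernel_Fubini mK iK mB1 B1C).
transitivity (\int[mu]_(t in P) (K t * \int[mu]_(s in P) B2 (s, t))).
  apply: eq_Rintegral => t _; congr (_ * _).
  rewrite -(@Rintegral_period_shift _ (fun x => B1 (x, t)) t).
  - by apply: eq_Rintegral => s _; rewrite /B1 /B2/= [t + s]addrC addrK.
  - exact: (@measurable_fun_pair1 _ _ _ _ _ _ B1 t mB1).
  - by move=> x; rewrite /B1/= psiL addrAC phiL.
rewrite -(kernel_Fubini mK iK mB2 B2C).
apply: eq_Rintegral => s _; rewrite /convolution -RintegralZl//.
- apply: eq_Rintegral => t _; rewrite /B2/= /psi mulrCA.
  by congr (_ * (_ * phi_n _ _)); ring.
- exact: mP.
- apply: (@integrable_mul_bounded _ _ _ mu P mP _ _ 1) => //.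
    exact: measurable_funTS (measurable_phi_reflect n (- s)).
  by move=> t _; exact: phi_n_le1.
Qed.

(** The test function is, up to reflection, the sign of [f] on the set where
    [|f|] exceeds [c], divided by the measure of that set: its mean norm is [1]
    and its integral against [f] is at least [c]. *)
Lemma best_approx_one_ge_lt (c : R) : 0 <= c ->
  (c%:E < normLp +oo%E (EFin \o f))%E ->
  (c%:E <= best_approx (conv_class K 1%E) (trigpoly n) 1%E)%E.
Proof.
move=> c0 cf.
have mf := measurable_convolution_phi n0 mK iK.
have fL := periodic_convolution_phi n0 iK.
pose A : set (measurableTypeR R) := [set x | c < `|f x|].
have mA : measurable A.
  rewrite (_ : A = [set: R] `&` [set x | (c%:E < `|(f x)%:E|)%E]); last first.
    by rewrite setTI; apply/seteqP; split.
  apply: emeasurable_fun_o_infty => //; apply: measurableT_comp => //.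
  exact/measurable_EFinP.
have pA : period_mu A \is a fin_num by exact: fin_num_measure.
pose a := fine (period_mu A).
have a0 : 0 < a.
  rewrite fine_gt0// -ge0_fin_numE// pA andbT lt_neqAle measure_ge0 andbT.
  apply/eqP => pA0; move: cf; rewrite ltNge => /negP; apply.
  apply: normLp_infty_le; exists A; split => //.
  by move=> x /=; rewrite lee_fin => /negP; rewrite -ltNge.
pose g x : R := if c < f x then 1 else if f x < - c then -1 else 0.
have gA x : `|g x| = \1_A x.
  have -> : \1_A x = (nat_of_bool (c < `|f x|)%R)%:R :> R.
    by rewrite indicE; congr (nat_of_bool _)%:R; apply/idP/idP; rewrite inE.
  rewrite /g; have [fx|fx] := ltP c (f x).
    by rewrite normr1 (lt_le_trans fx (ler_norm _)).
  have [fxN|fxN] := ltP (f x) (- c).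
    by rewrite normrN1 -normrN (@lt_le_trans _ _ (- f x)) ?ler_norm// ltrNr.
  by rewrite normr0 ltNge ler_norml fxN fx.
have gf x : c * \1_A x <= g x * f x.
  rewrite -gA /g; have [fx|fx] := ltP c (f x).
    by rewrite normr1 mulr1 mul1r ltW.
  have [fxN|fxN] := ltP (f x) (- c); first by rewrite normrN1; lra.
  by rewrite normr0 mulr0 mul0r.
have mg : measurable_fun setT g.
  apply: measurable_fun_if => //; first exact: measurable_fun_ltr.
  apply: measurable_funTS; apply: measurable_fun_if => //.
  exact: measurable_fun_ltr.
have gL : periodic g (2 * pi) by move=> x; rewrite /g fL.
have g1 x : `|g x| <= 1 by rewrite gA indicE; case: (_ \in _).
pose phi s := a^-1 * g (- s).
have mphi : measurable_fun setT phi.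
  by apply: measurable_funM => //; apply: measurableT_comp mg _.
have phiL : periodic phi (2 * pi).
  by move=> x; rewrite /phi -[in LHS]gL; congr (_ * g _); ring.
have phiC x : `|phi x| <= a^-1.
  by rewrite normrM gtr0_norm ?invr_gt0// ler_piMr// invr_ge0 ltW.
have int1A : (\int[mu]_(x in P) (\1_A x)%:E = a%:E)%E.
  rewrite -ge0_integral_period_mu//; last exact/measurable_EFinP/measurable_indic.
  by rewrite integral_indic// setIT fineK.
have norm_phi : (normLp 1%E (EFin \o phi) = 1)%E.
  rewrite normLp1E//.
  pose w y : \bar R := (a^-1 * \1_A y)%:E.
  have mw : measurable_fun setT w.
    by apply/measurable_EFinP; apply: measurable_funM => //; exact: measurable_indic.
  have w0 y : (0 <= w y)%E by rewrite lee_fin mulr_ge0// ?invr_ge0 ?ltW.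
  have wL y : w (y + 2 * pi) = w y by rewrite /w -!gA gL.
  transitivity (\int[mu]_(s in P) w (0 - s)%R)%E.
    apply: eq_integral => s _; rewrite sub0r /phi normrM gA gtr0_norm// invr_gt0//.
  rewrite ge0_integral_period_reflect// /w.
  under eq_integral => y _ do rewrite EFinM.
  rewrite ge0_integralZl_EFin//.
  - by rewrite int1A -EFinM mulVf// gt_eqF.
  - exact: mP.
  - by apply: measurable_funTS; apply/measurable_EFinP; exact: measurable_indic.
  - by rewrite invr_ge0 ltW.
apply: (@best_approx_ge _ _ _ _ _ phi).
  by apply: F_ballP => //; rewrite norm_phi.
move=> T tT; set h := convolution K phi.
have mphi2 : measurable_fun setT (fun z : R * R => phi (z.1 - z.2)).
  by apply: measurableT_comp mphi _; exact: measurable_funB.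
have mh : measurable_fun setT h.
  exact: (measurable_kernel_integral mK iK mphi2 (fun z => phiC (z.1 - z.2))).
have ih : mu.-integrable P (EFin \o h).
  exact: (integrable_kernel_integral mK iK mphi2 (fun z => phiC (z.1 - z.2))).
have mT := measurable_trigpoly tT.
have iT := trigpoly_integrable tT.
have ihT : mu.-integrable P (EFin \o (h \- T)).
  rewrite (_ : _ \o _ = (EFin \o h) \- (EFin \o T))%E//.
  by apply: integrableB => //; exact: mP.
have ipsi q : mu.-integrable P (EFin \o q) ->
    mu.-integrable P (EFin \o (fun x => q x * psi x)).
  move=> iq; apply: (@integrable_mul_bounded _ _ _ mu P mP _ _ 1) => //.
    exact: measurable_funTS mpsi.
  by move=> x _; exact: phi_n_le1.
rewrite normLp1E//; last exact: measurable_funB.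
have iabs : mu.-integrable P (EFin \o (fun x => `|(h \- T) x|)).
  exact: (integrable_abse ihT).
rewrite -[leRHS]fineK; last by apply: integrable_fin_num => //; exact: mP.
rewrite lee_fin -[leRHS]/(\int[mu]_(x in P) `|(h \- T) x|).
apply: (@le_trans _ _ `|\int[mu]_(x in P) ((h \- T) x * psi x)|); last first.
  apply: (le_trans (le_normr_Rintegral mP (ipsi _ ihT))).
  apply: le_Rintegral; [exact: mP| |exact: iabs|].
    exact: (integrable_abse (ipsi _ ihT)).
  by move=> x _; rewrite normrM ler_piMr//; exact: phi_n_le1.
have -> : \int[mu]_(x in P) ((h \- T) x * psi x) =
    \int[mu]_(x in P) (h x * psi x).
  transitivity (\int[mu]_(x in P) (h x * psi x) - \int[mu]_(x in P) (T x * psi x)).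
    rewrite -RintegralB//; [|exact: mP|exact: ipsi|exact: ipsi].
    by apply: eq_Rintegral => x _; rewrite /= mulrBl.
  rewrite (@trigpoly_orthogonal _ n T psi 1)// ?subr0// => x.
  exact: phi_n_le1.
rewrite (convolution_adjoint mphi phiL phiC).
have mphin2 : measurable_fun setT (fun z : R * R => phi_n n (z.1 - z.2)).
  by apply: measurableT_comp (@measurable_phi_n R n) _; exact: measurable_funB.
have i_f : mu.-integrable P (EFin \o f).
  by apply: (integrable_kernel_integral mK iK mphin2 (C := 1)) => z; exact: phi_n_le1.
have igf : mu.-integrable P (EFin \o (fun s => g s * f s)).
  rewrite (_ : _ \o _ = fun s => (f s * g s)%:E); last first.
    by apply/funext => s /=; rewrite mulrC.
  apply: (@integrable_mul_bounded _ _ _ mu P mP _ _ 1) => //.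
  exact: measurable_funTS.
have -> : \int[mu]_(s in P) (phi s * f (- s)) =
    a^-1 * \int[mu]_(s in P) (g s * f s).
  rewrite -RintegralZl//; last exact: mP.
  rewrite -(@Rintegral_period_reflect _ (fun s => a^-1 * (g s * f s)) 0).
  - by apply: eq_Rintegral => s _; rewrite sub0r /phi mulrA.
  - by apply: measurable_funM => //; exact: measurable_funM.
  - by move=> s; rewrite gL fL.
have i1A : mu.-integrable P (EFin \o (\1_A : R -> R)).
  apply: measurable_bounded_integrable; first exact: mP.
  - exact: lebesgue_measure_period_lty.
  - exact: measurable_funTS (measurable_indic mA).
  - exists 1; split; first exact: num_real.
    by move=> M M1 x _ /=; rewrite -gA normr_id; exact: le_trans (g1 x) (ltW M1).
apply: le_trans (ler_norm _); rewrite mulrC ler_pdivlMr//.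
rewrite (_ : a = \int[mu]_(x in P) \1_A x); last by rewrite /Rintegral int1A.
rewrite -RintegralZl//; last exact: mP.
apply: le_Rintegral => //; first exact: mP.
rewrite (_ : _ \o _ = fun x => (\1_A x * c)%:E); last first.
  by apply/funext => s /=; rewrite mulrC.
by apply: (@integrable_mul_bounded _ _ _ mu P mP _ _ `|c|).
Qed.

(** If the norm of [f] exceeded the error [e] by more than some [d > 0], then
    [best_approx_one_ge_lt] with [c = e + d] would give [e + d <= e]. *)
Lemma best_approx_one_ge :
  (normLp +oo%E (EFin \o f) <= best_approx (conv_class K 1%E) (trigpoly n) 1%E)%E.
Proof.
have : (0 <= best_approx (conv_class K 1%E) (trigpoly n) 1%E)%E.
  apply: (@best_approx_ge _ _ _ _ _ (cst 0)) => [|T _]; last exact: normLp_ge0.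
  apply: F_ballP; [exact: measurable_cst|by []|].
  by rewrite (_ : _ \o _ = cst 0%E)// /normLp Lnorm0// lee01.
have := best_approx_one_ge_lt.
case: (best_approx _ _ _) => [e| |] ge_lt e0 //; last by rewrite leey.
apply/lee_addgt0Pr => d d0; rewrite leNgt; apply/negP => lt.
have := ge_lt (e + d); rewrite EFinD => /(_ _ lt); rewrite -EFinD !lee_fin.
rewrite lee_fin in e0; have e_d : 0 <= e + d by lra.
by move=> /(_ e_d); lra.
Qed.

(** The point [theta] is at most [pi], hence has points of the period to its
    right, and the continuous function cannot exceed its essential bound there. *)
Lemma kernel_norm_le T theta : trigpoly n T -> 0 <= theta <= pi / n%:R ->
  {ae mu, forall x, 0 <= (K x - T x) * phi_n n (x - theta)} ->
  (\int[mu]_(t in P) `|K t - T t|%:E <= normLp +oo%E (EFin \o f))%E.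
Proof.
move=> tT /andP[th0 thn] sgnD.
rewrite (convolution_phi_at_theta n0 mK iK tT sgnD).
apply: ae_le_continuous; first exact: continuous_convolution_phi.
  rewrite th0 (le_lt_trans thn)// (@le_lt_trans _ _ pi)//.
    rewrite ler_piMr ?pi_ge0// invf_le1 ?ltr0n// ler1n//.
  by have := pi_gt0 R; lra.
exact: (@ae_normLp_infty R (EFin \o f)).
Qed.

End scalar_class_one.

(** * Measurable selections of compact-valued maps *)

Section open_exhaustion.
Variables (R : realType) (V : pseudoMetricType R).

Let r (j : nat) : R := j.+1%:R^-1.

Let r_gt0 j : 0 < r j. Proof. by rewrite invr_gt0. Qed.

(** Used to reduce a condition on [U] to conditions on the sets [W j], whose
    closures stay inside [U], so that minima over a compact set do not escape
    from [U]. *)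
Lemma open_exhaustion (U : set V) : open U ->
  exists W : nat -> set V, [/\ forall j, open (W j),
    forall j, closure (W j) `<=` U & U = \bigcup_j W j].
Proof.
move=> oU; pose W j := [set y | ball y (r j) `<=` U]°; exists W; split.
- by move=> j; exact: open_interior.
- move=> j z /(_ (ball z (r j)) (nbhsx_ballx _ _ (r_gt0 j)))[y [Wy zy]].
  by apply: (interior_subset Wy); exact: ball_sym.
- apply/seteqP; split => [y Uy|y [j _ Wy]]; last first.
    by apply: (interior_subset Wy); exact: ballxx.
  have /nbhs_ballP[e /= e0 yeU] : nbhs y U by exact: open_nbhs_nbhs.
  have [k] : exists k, r k < e / 2.
    have e20 : 0 < e / 2 by rewrite divr_gt0.
    exists (Num.truncn (e / 2)^-1); rewrite /r invf_plt ?posrE ?ltr0n//.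
    exact: truncnS_gt.
  move=> rk; exists k => //; apply/nbhs_ballP; exists (r k) => //= z yz w zw.
  apply: yeU; apply: (@le_ball _ _ _ (r k + r k)); first by rewrite ltW//; lra.
  exact: ball_triangle yz zw.
Qed.

End open_exhaustion.

Section measurable_selection.
Variables (R : realType) (m : nat).
Implicit Types (f g : R -> set 'rV[R]_m) (i : 'I_m).

Lemma open_coord_lt i (s : R) : open [set a : 'rV[R]_m | a 0 i < s].
Proof.
apply: (@open_comp _ _ (fun a : 'rV[R]_m => a 0 i) [set y | y < s]).
  by move=> a _; exact: coord_continuous.
exact: open_lt.
Qed.

Lemma closed_coord_le i (s : R) : closed [set a : 'rV[R]_m | a 0 i <= s].
Proof.
apply: (@closed_comp _ _ (fun a : 'rV[R]_m => a 0 i) [set y | y <= s]).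
  by move=> a _; exact: coord_continuous.
exact: closed_le.
Qed.

Lemma compact_coord_min (A : set 'rV[R]_m) i : compact A -> A !=set0 ->
  exists2 a, A a & forall b, A b -> a 0 i <= b 0 i.
Proof.
move=> cA A0; have [|a aA amin] := @compact_EVT_min _ R
    (fun a : 'rV[R]_m => a 0 i) A A0 cA.
  by apply: continuous_subspaceT => a; exact: coord_continuous.
exists a; first exact/set_mem.
by move=> b Ab; apply: amin; exact/mem_set.
Qed.

(** The condition [a 0 i <= c t] is closed, whereas measurability of [f] tests
    open sets only. It is therefore replaced by the conditions
    [a 0 i < c t + (k + 1)^-1] for all [k], with the moving threshold replaced by
    rational ones. They may be
    met by a different point of [W j] for each [k], but then the minimum of the
    coordinate over the compact set [f t `&` closure (W j)] is at most [c t], and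
    it is attained in [U]. *)
Lemma sv_measurable_argmin f i : compact_valued f -> sv_measurable f ->
  exists g (c : R -> R), [/\ compact_valued g, sv_measurable g,
    (forall t, g t `<=` f t), measurable_fun setT c &
    forall t a, g t a -> a 0 i = c t].
Proof.
move=> cf mf.
have /choice[b bP] t : exists a, f t a /\ forall a', f t a' -> a 0 i <= a' 0 i.
  by have [ct nt] := cf t; have [a] := compact_coord_min i ct nt; exists a.
pose c t := b t 0 i.
have mc : measurable_fun setT c.
  apply: (measurability _ (RGenInftyO.measurableE R)) => _ [_ [s ->] <-].
  rewrite setTI (_ : _ @^-1` _ =
    [set t | f t `&` [set a | a 0 i < s] !=set0]).
    by apply: mf; exact: open_coord_lt.
  apply/seteqP; split => t /=; rewrite in_itv/=.
    by move=> cs; exists (b t); split => //=; exact: (bP t).1.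
  by move=> [a [fa /= as_]]; exact: le_lt_trans ((bP t).2 a fa) as_.
pose g t := f t `&` [set a | a 0 i <= c t].
exists g, c; split => //.
- move=> t; split; last by exists (b t); split => //=; exact: (bP t).1.
  by apply: compact_closedI; [exact: (cf t).1|exact: closed_coord_le].
- move=> U oU; have [W [oW WU UW]] := open_exhaustion oU.
  pose S j k (q : rat) := [set t | ratr q < c t + k.+1%:R^-1] `&`
    [set t | f t `&` (W j `&` [set a | a 0 i < ratr q]) !=set0].
  rewrite (_ : [set x | _] = \bigcup_j \bigcap_k \bigcup_q S j k q); last first.
    apply/seteqP; split => t /=.
      move=> [a [[fa ac] Ua]]; move: Ua; rewrite UW => -[j _ Wa].
      exists j => // k _.
      have /= act : a 0 i < c t + k.+1%:R^-1.
        by rewrite (le_lt_trans ac)// ltrDl invr_gt0.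
      have [q] := rat_in_itvoo act; rewrite in_itv/= => /andP[q1 q2].
      by exists q => //; split => //; exists a.
    move=> [j _ Sj].
    have cC : compact (f t `&` closure (W j)).
      by apply: compact_closedI; [exact: (cf t).1|exact: closed_closure].
    have [|a [fa Wa] amin] := compact_coord_min i cC.
      have [q _ [_ [a [fa [Wa _]]]]] := Sj 0%N Logic.I.
      by exists a; split => //; exact: subset_closure.
    exists a; split; last exact: WU Wa.
    split => //=; apply/ler_addgt0Pr => e e0.
    have [q _ [/= q1 [a' [fa' [Wa' /= a'q]]]]] := Sj (Num.truncn e^-1) Logic.I.
    apply: (@le_trans _ _ (a' 0 i)).
      by apply: amin; split => //; exact: subset_closure.
    rewrite (le_trans (ltW a'q))// (le_trans (ltW q1))// lerD2l.
    by rewrite invf_ple ?posrE// ltW// truncnS_gt.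
  apply: bigcupT_measurable => j; apply: bigcapT_measurable => k.
  apply: bigcupT_measurable_rat => q; apply: measurableI.
    rewrite (_ : [set t | _] =
        setT `&` c @^-1` `]ratr q - k.+1%:R^-1, +oo[%classic).
      by apply: mc => //; exact: measurable_itv.
    by rewrite setTI; apply/seteqP; split => t /=; rewrite in_itv/= andbT ltrBlDr.
  by apply: mf; apply: openI; [exact: oW|exact: open_coord_lt].
- by move=> t a [].
- by move=> t a [fa /= ac]; apply/eqP; rewrite eq_le ac/=; exact: (bP t).2.
Qed.

(** The lexicographic minimum: minimizing the coordinates one after the other
    leaves, after [m] steps, a single point, whose coordinates are the successive
    minima. *)
Theorem measurable_selection f : compact_valued f -> sv_measurable f ->
  exists psi : R -> 'rV[R]_m, (forall t, f t (psi t)) /\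
    forall i, measurable_fun setT (fun t => psi t 0 i).
Proof.
move=> cf mf.
have step k : (k <= m)%N -> exists g, [/\ compact_valued g, sv_measurable g,
    (forall t, g t `<=` f t) & forall i, (i < k)%N ->
      exists2 c : R -> R, measurable_fun setT c &
        forall t a, g t a -> a 0 i = c t].
  elim: k => [_|k IH km]; first by exists f; split => // t; exact: subset_refl.
  have [g [cg mg gf gc]] := IH (ltnW km).
  have [h [c [ch mh hg mc hc]]] := sv_measurable_argmin (Ordinal km) cg mg.
  exists h; split => //; first by move=> t a /hg/gf.
  move=> i; rewrite ltnS leq_eqVlt => /predU1P[ik|ik].
    exists c => // t a /hc <-; congr (a 0 _); exact/val_inj.
  have [c' mc' c'P] := gc i ik.
  by exists c' => // t a /hg; exact: c'P.
have [g [cg _ gf gc]] := step m (leqnn m).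
have /choice[c cP] (i : 'I_m) : exists c : R -> R, measurable_fun setT c /\
    forall t a, g t a -> a 0 i = c t.
  by have [c] := gc i (ltn_ord i); exists c.
exists (fun t => \row_i c i t); split => [t|i]; last first.
  rewrite (_ : (fun _ => _) = c i); first exact: (cP i).1.
  by apply/funext => t; rewrite mxE.
have [a ga] := (cg t).2; apply: gf.
by rewrite (_ : (\row_i _) = a)//; apply/rowP => i; rewrite mxE -((cP i).2 t a ga).
Qed.

End measurable_selection.

(** * Euclidean norm and Hausdorff distance *)

Section euclidean.
Variables (R : realType) (m : nat).
Implicit Types (u v : 'rV[R]_m) (A B : set 'rV[R]_m).

Lemma enorm_ge0 u : 0 <= enorm u.
Proof. exact: sqrtr_ge0. Qed.

Lemma enorm_sqr u : enorm u ^+ 2 = \sum_(i < m) u 0 i ^+ 2.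
Proof. by rewrite sqr_sqrtr// sumr_ge0// => i _; exact: sqr_ge0. Qed.

Lemma ler_coord_enorm u i : `|u 0 i| <= enorm u.
Proof.
rewrite -(@ler_pXn2r _ 2)//= ?nnegrE ?enorm_ge0// enorm_sqr real_normK ?num_real//.
by rewrite (bigD1 i)//= lerDl sumr_ge0// => j _; exact: sqr_ge0.
Qed.

Lemma enormZ (c : R) u : enorm (c *: u) = `|c| * enorm u.
Proof.
rewrite /enorm -sqrtr_sqr -sqrtrM ?sqr_ge0// mulr_sumr.
by congr Num.sqrt; apply: eq_bigr => i _; rewrite mxE exprMn.
Qed.

Lemma enormN u : enorm (- u) = enorm u.
Proof. by rewrite -scaleN1r enormZ normrN1 mul1r. Qed.

Lemma enorm_delta i : enorm (delta_mx 0 i : 'rV[R]_m) = 1.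
Proof.
rewrite /enorm (bigD1 i)//= mxE !eqxx expr1n big1 ?addr0 ?sqrtr1// => j ji.
by rewrite mxE (negbTE ji) andbF expr0n.
Qed.

Lemma enorm_le_sum u : enorm u <= \sum_(i < m) `|u 0 i|.
Proof.
rewrite -(@ler_pXn2r _ 2)//= ?nnegrE ?enorm_ge0 ?sumr_ge0// enorm_sqr expr2.
rewrite mulr_suml; apply: ler_sum => i _; rewrite -real_normK ?num_real// expr2.
apply: ler_wpM2l => //; rewrite (bigD1 i)//= lerDl sumr_ge0//.
Qed.

Lemma enorm_cauchy_schwarz u v :
  \sum_(i < m) u 0 i * v 0 i <= enorm u * enorm v.
Proof.
set a := enorm u; set b := enorm v.
have a0 : 0 <= a := enorm_ge0 u; have b0 : 0 <= b := enorm_ge0 v.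
have zero w w' : enorm w = 0 -> \sum_(i < m) w 0 i * w' 0 i = 0 :> R.
  move=> w0; rewrite big1// => i _.
  have /eqP : `|w 0 i| = 0.
    by apply/eqP; rewrite eq_le normr_ge0 andbT -w0 ler_coord_enorm.
  by rewrite normr_eq0 => /eqP ->; rewrite mul0r.
have [u0|uN0] := eqVneq a 0; first by rewrite zero// u0 mul0r.
have [v0|vN0] := eqVneq b 0.
  rewrite (eq_bigr (fun i => v 0 i * u 0 i)) => [|i _]; last by rewrite mulrC.
  by rewrite zero// v0 mulr0.
have ab : 0 < a * b by rewrite mulr_gt0// lt_neqAle eq_sym ?uN0 ?vN0.
have : 0 <= \sum_(i < m) (b * u 0 i - a * v 0 i) ^+ 2.
  by rewrite sumr_ge0// => i _; exact: sqr_ge0.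
rewrite (eq_bigr (fun i => b ^+ 2 * u 0 i ^+ 2 + a ^+ 2 * v 0 i ^+ 2 -
    2 * (a * b) * (u 0 i * v 0 i))) => [|i _]; last by ring.
rewrite sumrB big_split/= -!mulr_sumr -!enorm_sqr -/a -/b.
set s := \sum_(i < m) _ => h.
have : 0 <= (a * b) * (a * b - s) by nra.
by rewrite pmulr_rge0// subr_ge0.
Qed.

Lemma hausdorff_le A B (M : \bar R) :
  (forall a, A a -> exists2 b, B b & ((enorm (a - b))%:E <= M)%E) ->
  (forall b, B b -> exists2 a, A a & ((enorm (a - b))%:E <= M)%E) ->
  (hausdorff A B <= M)%E.
Proof.
move=> AB BA; rewrite /hausdorff ge_max; apply/andP; split.
  apply: ge_ereal_sup => _ [a Aa <-]; have [b Bb abM] := AB a Aa.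
  by apply: ge_ereal_inf; exists (enorm (a - b))%:E => //; exists b.
apply: ge_ereal_sup => _ [b Bb <-]; have [a Aa abM] := BA b Bb.
by apply: ge_ereal_inf; exists (enorm (a - b))%:E => //; exists a.
Qed.

Lemma hausdorff_ge0 A B : A !=set0 -> (0 <= hausdorff A B)%E.
Proof.
move=> [a Aa]; rewrite /hausdorff le_max; apply/orP; left.
apply: le_ereal_sup_tmp; eexists; first by exists a.
by apply: le_ereal_inf_tmp => _ [b _ <-]; rewrite lee_fin enorm_ge0.
Qed.

(** This covers [A = set0], where the infimum over [A] is [+oo]. It is applied
    to a convolution that is empty at points where it is not integrable. *)
Lemma hausdorff_ge_enorm A B a b : A `<=` [set a] -> B b ->
  ((enorm (a - b))%:E <= hausdorff A B)%E.
Proof.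
move=> Aa Bb; rewrite /hausdorff le_max; apply/orP; right.
apply: le_ereal_sup_tmp; eexists; first by exists b.
by apply: le_ereal_inf_tmp => _ [a' /Aa -> <-].
Qed.

Lemma hausdorff_set1 u v : hausdorff [set u] [set v] = (enorm (u - v))%:E.
Proof.
apply/eqP; rewrite eq_le hausdorff_ge_enorm// andbT.
by apply: hausdorff_le => _ ->; eexists.
Qed.

Lemma enorm_le_set_norm A a : A a -> ((enorm a)%:E <= set_norm A)%E.
Proof.
move=> Aa; rewrite /set_norm /hausdorff le_max; apply/orP; left.
apply: le_ereal_sup_tmp; eexists; first by exists a.
by apply: le_ereal_inf_tmp => _ [b -> <-]; rewrite subr0.
Qed.

(** Each coordinate is bounded on [A], and the Euclidean norm is at most the
    sum of the moduli of the coordinates. *)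
Lemma set_norm_fin_num A : compact A -> A !=set0 -> set_norm A \is a fin_num.
Proof.
move=> cA A0; rewrite ge0_fin_numE ?hausdorff_ge0//.
have /choice[M MP] i : exists M : R, forall a, A a -> `|a 0 i| <= M.
  have [|a aA amax] := @compact_EVT_max _ R (fun a : 'rV[R]_m => `|a 0 i|) A A0 cA.
    apply: continuous_subspaceT => a.
    apply: (@continuous_comp _ _ _ (fun a : 'rV[R]_m => a 0 i) (@Num.norm R R)).
      exact: coord_continuous.
    exact: norm_continuous.
  by exists `|a 0 i| => b Ab; apply: amax; exact/mem_set.
have AM a : A a -> enorm a <= \sum_(i < m) M i.
  by move=> Aa; apply: le_trans (enorm_le_sum a) _; apply: ler_sum => i _; exact: MP.
apply: (@le_lt_trans _ _ (\sum_(i < m) M i)%:E); last exact: ltry.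
have [a0 Aa0] := A0.
apply: hausdorff_le => [a Aa|_ ->].
  by exists 0 => //; rewrite subr0 lee_fin AM.
by exists a0 => //; rewrite subr0 lee_fin AM.
Qed.

(** Test the integral against its own direction and use Cauchy-Schwarz under
    the integral sign. *)
Lemma enorm_integral_le (D : set R) (u : R -> 'rV[R]_m) (w : R -> R) :
  measurable (D : set (measurableTypeR R)) ->
  (forall i, lebesgue_measure.-integrable D (fun t => (u t 0 i)%:E)) ->
  lebesgue_measure.-integrable D (EFin \o w) ->
  (forall t, D t -> enorm (u t) <= w t) ->
  enorm (\row_i \int[lebesgue_measure]_(t in D) u t 0 i) <=
    \int[lebesgue_measure]_(t in D) w t.
Proof.
move=> mD iu iw uw; set v := \row_i _.
have w0 : 0 <= \int[lebesgue_measure]_(t in D) w t.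
  by apply: Rintegral_ge0 => t Dt; exact: le_trans (enorm_ge0 _) (uw t Dt).
have [->//|vN0] := eqVneq (enorm v) 0.
have v0 : 0 < enorm v by rewrite lt_neqAle eq_sym vN0 enorm_ge0.
rewrite -(ler_pM2l v0) -expr2 enorm_sqr -RintegralZl//.
have -> : \sum_(i < m) v 0 i ^+ 2 =
    \int[lebesgue_measure]_(t in D) (\sum_(i < m) v 0 i * u t 0 i).
  rewrite Rintegral_sum//.
    apply: eq_bigr => i _; rewrite RintegralZl//; last exact: iu.
    by rewrite expr2; congr (_ * _); rewrite mxE.
  move=> i; exact: (integrableZl mD _ (iu i)).
apply: le_Rintegral => //.
- rewrite (_ : _ \o _ = fun t => \sum_(i < m) (v 0 i * u t 0 i)%:E)%E.
    by apply: integrable_sum => // i _; exact: (integrableZl mD _ (iu i)).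
  by apply/funext => t /=; rewrite sumEFin.
- exact: (integrableZl mD _ iw).
- move=> t Dt; apply: le_trans (enorm_cauchy_schwarz _ _) _.
  by rewrite ler_pM2l// uw.
Qed.

End euclidean.

(** * Aumann integrals of scaled set-valued functions *)

Section nonmeasurable_integrands.
Context d (T : measurableType d) (R : realType).
Variable mu : {measure set T -> \bar R}.
Implicit Types f g : T -> \bar R.
Local Open Scope ereal_scope.

(** The integral of a nonnegative function is a supremum over simple functions
    below it, hence monotone without measurability. Hausdorff
    distances of convolutions are integrated by means of it. *)
Lemma ge0_le_integral_nonmeas f g : (forall x, 0 <= f x) ->
  (forall x, f x <= g x) -> \int[mu]_x f x <= \int[mu]_x g x.
Proof.
move=> f0 fg; rewrite !ge0_integralTE//; last first.
  by move=> x; exact: le_trans (fg x).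
by apply: ereal_sup_le => _ [h hf <-]; exists h => // x; exact: le_trans (fg x).
Qed.

(** Adding [+oo] on the exceptional null set makes the inequality hold
    everywhere and does not change the integral of [g]. *)
Lemma ae_le_integral_nonmeas f g : (forall x, 0 <= f x) ->
  (forall x, 0 <= g x) -> measurable_fun setT g ->
  {ae mu, forall x, f x <= g x} -> \int[mu]_x f x <= \int[mu]_x g x.
Proof.
move=> f0 g0 mg [N [mN N0 fgN]].
have mI : measurable_fun setT (fun x => +oo * (\1_N x)%:E : \bar R).
  by apply: measurable_funeM; apply/measurable_EFinP; exact: measurable_indic.
have I0 x : 0 <= +oo * (\1_N x)%:E :> \bar R by rewrite mule_ge0// lee_fin.
have -> : \int[mu]_x g x = \int[mu]_x (g x + +oo * (\1_N x)%:E).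
  rewrite ge0_integralD// ge0_integralZl//.
    by rewrite integral_indic// setIT [X in _ * X]N0 mule0 adde0.
  by apply/measurable_EFinP; exact: measurable_indic.
apply: ge0_le_integral_nonmeas => // x.
have [xN|xN] := boolP (x \in N).
  by rewrite indicE xN mule1 addey ?leey// gt_eqF// (lt_le_trans _ (g0 x)).
rewrite indicE (negbTE xN) mule0 adde0.
by apply: contrapT => nfg; move/negP: xN; apply; rewrite inE; exact: fgN.
Qed.

End nonmeasurable_integrands.

(** [x^-1 = x * (x ^ 2) `^ (-1)], also at [0], reduces inversion to a power
    function. *)
Lemma measurable_invr (R : realType) : measurable_fun setT (fun x : R => x^-1).
Proof.
rewrite (_ : (fun _ => _) = fun x : R => x * ((x ^+ 2) `^ (-1))).
  apply: measurable_funM => //.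
  apply: (measurableT_comp (f := fun y : R => y `^ (-1)) (g := fun x : R => x ^+ 2)).
    exact: measurable_powR.
  exact: measurable_funX.
apply/funext => x; rewrite powR_inv1 ?sqr_ge0//.
have [->|x0] := eqVneq x 0; first by rewrite invr0 mul0r.
by field.
Qed.

Lemma ae_eq_integrable d (T : measurableType d) (R : realType)
    (mu : {measure set T -> \bar R}) (D : set T) (f g : T -> \bar R) :
  measurable D -> measurable_fun D g -> ae_eq mu D f g ->
  mu.-integrable D f -> mu.-integrable D g.
Proof.
move=> mD mg fg /integrableP[mf foo]; apply/integrableP; split => //.
suff <- : (\int[mu]_(x in D) `|f x| = \int[mu]_(x in D) `|g x|)%E by [].
apply: ae_eq_integral => //.
- exact: measurableT_comp.
- exact: measurableT_comp.
- by apply: ae_impl fg => x fgx Dx /=; rewrite fgx.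
Qed.

Section aumann_integral.
Variables (R : realType) (m : nat).
Notation mu := (@lebesgue_measure R).
Notation P := (period_itv R).
Notation mP := (measurable_period_itv R).
Implicit Types (k : R -> R) (g : R -> set 'rV[R]_m) (v : 'rV[R]_m).

(** [svconv K g x] is [aumann (scaled (fun t => K (x - t)) g)] by
    conversion. *)
Definition scaled k g : R -> set 'rV[R]_m := fun t => [set k t *: a | a in g t].

Lemma aumann_intro k g (psi : R -> 'rV[R]_m) : (forall t, P t -> g t (psi t)) ->
  (forall i, mu.-integrable P (fun t => (k t * psi t 0 i)%:E)) ->
  aumann (scaled k g) (\row_i \int[mu]_(t in P) (k t * psi t 0 i)).
Proof.
move=> gpsi ikpsi; exists (fun t => k t *: psi t); split.
- by move=> i; apply: eq_integrable (ikpsi i) => [|t _]; [exact: mP|rewrite mxE].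
- by apply: aeW => t Pt; exists (psi t) => //; exact: gpsi.
- by apply/rowP => i; rewrite !mxE; apply: eq_Rintegral => t _; rewrite mxE.
Qed.

(** Divide the selection of [k *: g] by [k] where [k] does not vanish, and use
    any measurable selection of [g] elsewhere. *)
Lemma aumann_selection k g v : measurable_fun setT k ->
  compact_valued g -> sv_measurable g -> aumann (scaled k g) v ->
  exists psi : R -> 'rV[R]_m, [/\ forall t, P t -> g t (psi t),
    forall i, measurable_fun P (fun t => psi t 0 i),
    forall i, mu.-integrable P (fun t => (k t * psi t 0 i)%:E) &
    v = \row_i \int[mu]_(t in P) (k t * psi t 0 i)].
Proof.
move=> mk cg mg [phi [iphi [N [mN N0 phiN]] ->]].
have [sel [gsel msel]] := measurable_selection cg mg.
(* Cutting [k] off on the null set [N] makes [psi] a selection everywhere, not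
   only almost everywhere. *)
pose k' t := k t * \1_(~` N) t.
have k'E t : k' t = if t \in N then 0 else k t.
  by rewrite /k' indicE in_setC; case: (t \in N); rewrite ?mulr0 ?mulr1.
have phiP t : P t -> t \notin N -> exists2 a, g t a & k t *: a = phi t.
  move=> Pt /negP tN; apply: contrapT => h; apply: tN; rewrite inE.
  by apply: phiN => /(_ Pt).
pose psi t := if k' t == 0 then sel t else (k t)^-1 *: phi t.
have mphi i : measurable_fun P (fun t => phi t 0 i).
  by apply/measurable_EFinP; exact: (measurable_int mu (iphi i)).
have mk' : measurable_fun setT k'.
  by apply: measurable_funM => //; apply: measurable_indic; exact: measurableC.
have mpsi i : measurable_fun P (fun t => psi t 0 i).
  rewrite (_ : (fun t => _) = fun t => if k' t == 0 then sel t 0 i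
      else (k t)^-1 * phi t 0 i); last first.
    by apply/funext => t; rewrite /psi; case: ifP => // _; rewrite mxE.
  apply: measurable_fun_if; first exact: mP.
  - by apply: measurable_funTS; exact: measurable_fun_eqr.
  - exact: measurable_funTS (msel i).
  - apply: measurable_funM.
      apply: measurable_funTS.
      exact: (measurableT_comp (@measurable_invr R) mk).
    by apply: measurable_funS (mphi i) => //; exact: mP.
have gpsi t : P t -> g t (psi t).
  move=> Pt; rewrite /psi k'E; case: ifPn => [_|]; first exact: gsel.
  case: ifPn => [|tN k0]; first by rewrite eqxx.
  have [a ga <-] := phiP t Pt tN.
  by rewrite scalerA mulVf// scale1r.
have kpsi i : ae_eq mu P (fun t => (phi t 0 i)%:E) (fun t => (k t * psi t 0 i)%:E).
  exists N; split => // t /= /not_implyP[Pt ne]; apply: contrapT => tN.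
  apply: ne; congr (_%:E).
  have tN' : t \notin N by apply/negP; rewrite inE.
  have [a ga ka] := phiP t Pt tN'.
  rewrite /psi k'E (negbTE tN'); have [k0|k0] := eqVneq (k t) 0.
    by rewrite -ka k0 mul0r scale0r mxE.
  by rewrite mxE mulrA divff// mul1r.
have mkpsi i : measurable_fun P (fun t => (k t * psi t 0 i)%:E).
  by apply/measurable_EFinP; apply: measurable_funM => //; exact: measurable_funTS.
exists psi; split => //.
- by move=> i; exact: (ae_eq_integrable mP (mkpsi i) (kpsi i) (iphi i)).
- apply/rowP => i; rewrite !mxE /Rintegral; congr fine.
  apply: ae_eq_integral; first exact: mP.
  - exact: measurable_int (iphi i).
  - exact: mkpsi.
  - exact: kpsi.
Qed.

Section transfer.
Variables (g : R -> set 'rV[R]_m) (G : R -> R).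
Hypotheses (cg : compact_valued g) (mg : sv_measurable g)
  (mG : measurable_fun setT G) (gG : forall t a, g t a -> enorm a <= G t).

Let G0 t : 0 <= G t.
Proof. by have [a ga] := (cg t).2; exact: le_trans (enorm_ge0 a) (gG ga). Qed.

Lemma scaled_selection_integrable k (psi : R -> 'rV[R]_m) i :
  measurable_fun setT k -> mu.-integrable P (fun t => (k t * G t)%:E) ->
  (forall t, P t -> g t (psi t)) -> measurable_fun P (fun t => psi t 0 i) ->
  mu.-integrable P (fun t => (k t * psi t 0 i)%:E).
Proof.
move=> mk ikG gpsi mpsi; apply: le_integrable ikG; first exact: mP.
  apply/measurable_EFinP; apply: measurable_funM => //; exact: measurable_funTS.
move=> t Pt; rewrite lee_fin !normrM ler_wpM2l// (ger0_norm (G0 t)).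
exact: le_trans (ler_coord_enorm _ _) (gG (gpsi t Pt)).
Qed.

Lemma aumann_nonempty k : measurable_fun setT k ->
  mu.-integrable P (fun t => (k t * G t)%:E) -> aumann (scaled k g) !=set0.
Proof.
move=> mk ikG; have [sel [gsel msel]] := measurable_selection cg mg.
eexists; apply: (@aumann_intro k g sel) => // i.
by apply: scaled_selection_integrable => //; exact: measurable_funTS (msel i).
Qed.

(** The selection of [g] behind the given point of the first integral is reused
    with [k2]. *)
Lemma aumann_transfer k1 k2 v :
  measurable_fun setT k1 -> measurable_fun setT k2 ->
  mu.-integrable P (fun t => (k2 t * G t)%:E) -> aumann (scaled k1 g) v ->
  exists2 v', aumann (scaled k2 g) v' &
    ((enorm (v - v'))%:E <= \int[mu]_(t in P) (`|k1 t - k2 t| * G t)%:E)%E.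
Proof.
move=> mk1 mk2 ik2 /(aumann_selection mk1 cg mg)[psi [gpsi mpsi ik1psi ->]].
have ik2psi i := scaled_selection_integrable mk2 ik2 gpsi (mpsi i).
eexists; first exact: (@aumann_intro k2 g psi).
have mw : measurable_fun setT (fun t => `|k1 t - k2 t| * G t).
  by apply: measurable_funM => //; apply: measurableT_comp => //; exact: measurable_funB.
set M := (X in (_ <= X)%E); have M0 : (0 <= M)%E.
  by apply: integral_ge0 => t _; rewrite lee_fin mulr_ge0.
have [Moo|] := ltP M +oo%E; last by rewrite leye_eq => /eqP ->; rewrite leey.
have iw : mu.-integrable P (EFin \o (fun t => `|k1 t - k2 t| * G t)).
  apply/integrableP; split; first by apply/measurable_EFinP; exact: measurable_funTS.
  rewrite (_ : (\int[_]_(_ in _) _)%E = M)//.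
  by apply: eq_integral => t _; rewrite /= ger0_norm// mulr_ge0.
rewrite -[leRHS]fineK ?ge0_fin_numE// lee_fin.
have -> : \row_i \int[mu]_(t in P) (k1 t * psi t 0 i) -
    \row_i \int[mu]_(t in P) (k2 t * psi t 0 i) =
    \row_i \int[mu]_(t in P) ((k1 t - k2 t) *: psi t) 0 i.
  apply/rowP => i; rewrite !mxE -RintegralB//; [|exact: mP|exact: ik1psi|exact: ik2psi].
  by apply: eq_Rintegral => t _; rewrite !mxE mulrBl.
apply: (@enorm_integral_le R m P _ (fun t => `|k1 t - k2 t| * G t)) => //.
- exact: mP.
- move=> i; apply: (@eq_integrable _ _ _ mu P mP
    (fun t => (k1 t * psi t 0 i)%:E - (k2 t * psi t 0 i)%:E)%E).
    by move=> t _; rewrite mxE mulrBl EFinB.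
  by apply: integrableB => //; exact: mP.
- by move=> t Pt; rewrite enormZ ler_wpM2l// gG//; exact: gpsi.
Qed.

End transfer.
End aumann_integral.

(** * Upper bound for set-valued convolutions *)

Section convolution_tonelli.
Variable R : realType.
Notation mu := (@lebesgue_measure R).
Notation P := (period_itv R).
Notation mP := (measurable_period_itv R).
Variables (k G : R -> R).
Hypotheses (mk : measurable_fun setT k) (kL : periodic k (2 * pi))
  (mG : measurable_fun setT G) (G0 : forall t, 0 <= G t).

Let f (z : measurableTypeR R * measurableTypeR R) : \bar R :=
  (`|k (z.1 - z.2)| * G z.2)%:E.

Let f0 z : (0 <= f z)%E. Proof. by rewrite lee_fin mulr_ge0. Qed.

Let m1 : measurable_fun setT (fun z : R * R => z.1).
Proof. exact: measurable_fst. Qed.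

Let m2 : measurable_fun setT (fun z : R * R => z.2).
Proof. exact: measurable_snd. Qed.

Let mf : measurable_fun setT f.
Proof.
apply/measurable_EFinP; apply: measurable_funM; last exact: measurableT_comp mG _.
apply: measurableT_comp => //; apply: measurableT_comp mk _.
exact: measurable_funB.
Qed.

Let mkx x : measurable_fun setT (fun t : R => k (x - t)).
Proof. by apply: measurableT_comp mk _; exact: measurable_funB. Qed.

Let mfx x : measurable_fun setT (fun t : R => (`|k (x - t)| * G t)%:E).
Proof.
apply/measurable_EFinP; apply: measurable_funM => //.
exact: measurableT_comp (mkx x).
Qed.

Let FE : fubini_F period_mu f =
  (fun x : R => \int[mu]_(t in P) (`|k (x - t)| * G t)%:E)%E.
Proof. by apply/funext => x; rewrite /fubini_F /f/= integral_period_mu. Qed.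

Lemma measurable_abs_convolution :
  measurable_fun setT (fun x : R => \int[mu]_(t in P) (`|k (x - t)| * G t)%:E)%E.
Proof. by rewrite -FE; apply: measurable_fun_fubini_tonelli_F. Qed.

(** Tonelli, then translation invariance of the inner integral. *)
Lemma integral_abs_convolution :
  (\int[period_mu]_x \int[mu]_(t in P) (`|k (x - t)| * G t)%:E =
   \int[mu]_(t in P) `|k t|%:E * \int[mu]_(t in P) (G t)%:E)%E.
Proof.
rewrite -[LHS]/(\int[period_mu]_x (fun x : R => \int[mu]_(t in P) (`|k (x - t)| * G t)%:E) x)%E.
rewrite -FE; transitivity (\int[period_mu]_t \int[period_mu]_x f (x, t))%E.
  exact: fubini_tonelli.
have k0 : (0 <= \int[mu]_(t in P) `|k t|%:E)%E by exact: integral_ge0.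
transitivity (\int[period_mu]_t ((\int[mu]_(t in P) `|k t|%:E) * (G t)%:E))%E.
  apply: eq_integral => t _.
  have mkt : measurable_fun setT (fun x : R => `|k (- t + x)|%:E).
    apply/measurable_EFinP; apply: measurableT_comp => //.
    by apply: measurableT_comp mk _; exact: measurable_funD.
  transitivity (\int[period_mu]_x (`|k (- t + x)%R|%:E * (G t)%:E))%E.
    by apply: eq_integral => x _; rewrite /f/= -EFinM addrC.
  rewrite ge0_integralZr//; last by rewrite lee_fin.
  rewrite integral_period_mu// (@integral_period_shift _ (fun x => `|k x|%:E))//.
    by apply/measurable_EFinP; exact: measurableT_comp.
  by move=> x; rewrite kL.
rewrite ge0_integralZl//.
- by rewrite integral_period_mu//; apply/measurable_EFinP.
- by apply/measurable_EFinP.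
- by move=> x _; rewrite lee_fin.
Qed.

Lemma ae_integrable_convolution :
  mu.-integrable P (EFin \o k) -> mu.-integrable P (EFin \o G) ->
  {ae @period_mu R, forall x, mu.-integrable P (fun t => (k (x - t) * G t)%:E)}.
Proof.
move=> ik iG.
have iV : period_mu.-integrable setT
    (fun x : R => \int[mu]_(t in P) (`|k (x - t)| * G t)%:E)%E.
  apply/integrableP; split; first exact: measurable_abs_convolution.
  under eq_integral => x _.
    rewrite gee0_abs; last by apply: integral_ge0 => t _; rewrite lee_fin mulr_ge0.
    over.
  rewrite integral_abs_convolution.
  have /integrable_fin_num kfin := integrable_abse ik.
  have Gfin := integrable_fin_num mP iG.
  by rewrite ltey_eq fin_numM//; exact: (kfin mP).
apply: ae_impl (integrable_ae measurableT iV) => x /(_ Logic.I) Vfin.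
apply/integrableP; split.
  apply: measurable_funTS; apply/measurable_EFinP.
  by apply: measurable_funM => //; exact: mkx.
rewrite (_ : (\int[_]_(_ in _) _ = \int[mu]_(t in P) (`|k (x - t)| * G t)%:E)%E).
  by rewrite -ge0_fin_numE//; apply: integral_ge0 => t _; rewrite lee_fin mulr_ge0.
by apply: eq_integral => t _; rewrite /= normrM (ger0_norm (G0 t)).
Qed.

End convolution_tonelli.

Section set_valued_bounds.
Variables (R : realType) (m : nat).
Notation mu := (@lebesgue_measure R).
Notation P := (period_itv R).
Notation mP := (measurable_period_itv R).
Implicit Types (g : R -> set 'rV[R]_m).

Lemma normLp_le (p : \bar R) (f g : R -> \bar R) : p = 1%E \/ p = +oo%E ->
  (forall x, `|f x| <= `|g x|)%E -> (normLp p f <= normLp p g)%E.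
Proof.
move=> [->|->] fg; last by rewrite !normLp_infty; apply: le_ess_sup; exact: aeW.
by rewrite !normLp1; apply: ge0_le_integral_nonmeas.
Qed.

(** Finiteness of the norm of compact values lets the norm of [g] be handled as
    a real function. *)
Lemma PhiP (p : \bar R) g : Phi m p g ->
  exists G : R -> R, [/\ measurable_fun setT G, periodic G (2 * pi),
    mu.-integrable P (EFin \o G), (forall t a, g t a -> enorm a <= G t) &
    (normLp p (EFin \o G) <= 1)%E].
Proof.
move=> [[[cg mg gL ig] LpG] g1]; exists (fun t => fine (set_norm (g t))).
have gE t : set_norm (g t) = (fine (set_norm (g t)))%:E.
  by rewrite fineK// set_norm_fin_num; [|exact: (cg t).1|exact: (cg t).2].
split.
- by case: LpG => _; rewrite inE => /andP[]; rewrite !inE.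
- by move=> t; rewrite gL.
- by apply: eq_integrable ig => [|t _]; [exact: mP|rewrite gE].
- by move=> t a /enorm_le_set_norm; rewrite gE lee_fin.
- rewrite (_ : _ \o _ = fun t => hausdorff (g t) [set 0])//.
  by apply/funext => t /=; rewrite -gE.
Qed.

(** At almost every [x] both convolutions are integrable, and
    [aumann_transfer], used in both directions, bounds their distance by the
    convolution of [|K - T|] with the norm [G] of [g]. *)
Lemma distLpA_svconv_le (p : \bar R) (K T : R -> R) g :
  p = 1%E \/ p = +oo%E ->
  measurable_fun setT K -> periodic K (2 * pi) -> mu.-integrable P (EFin \o K) ->
  measurable_fun setT T -> periodic T (2 * pi) -> mu.-integrable P (EFin \o T) ->
  Phi m p g ->
  (distLpA p (svconv K g) (svconv T g) <= \int[mu]_(t in P) `|K t - T t|%:E)%E.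
Proof.
move=> hp mK KL iK mT TL iT Phig.
have [[[cg mg _ _] _] _] := Phig.
have [G [mG GL iG gG G1]] := PhiP Phig.
have G0 t : 0 <= G t.
  by have [a ga] := (cg t).2; exact: le_trans (enorm_ge0 a) (gG t a ga).
pose D t := K t - T t.
have mD : measurable_fun setT D by exact: measurable_funB.
have DL : periodic D (2 * pi) by move=> t; rewrite /D KL TL.
pose V x : \bar R := (\int[mu]_(t in P) (`|D (x - t)%R| * G t)%:E)%E.
have V0 x : (0 <= V x)%E by apply: integral_ge0 => t _; rewrite lee_fin mulr_ge0.
have mshift k x : measurable_fun setT k ->
    measurable_fun setT (fun t : R => k (x - t) : R).
  by move=> mk; apply: measurableT_comp mk _; exact: measurable_funB.
have HV : {ae @period_mu R, forall x,
    (`|hausdorff (svconv K g x) (svconv T g x)| <= V x)%E}.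
  apply: ae_impl2 (ae_integrable_convolution mK KL mG G0 iK iG)
    (ae_integrable_convolution mT TL mG G0 iT iG) => x iKG iTG.
  (* The distance of two empty sets is [-oo], whose absolute value is [+oo]. *)
  rewrite gee0_abs; last first.
    apply: hausdorff_ge0.
    exact: (aumann_nonempty cg mg gG (mshift K x mK) iKG).
  apply: hausdorff_le => [a|b].
    move=> /(aumann_transfer cg mg mG gG (mshift K x mK) (mshift T x mT) iTG).
    by move=> [b bT ab]; exists b.
  move=> /(aumann_transfer cg mg mG gG (mshift T x mT) (mshift K x mK) iKG).
  move=> [a aK ba]; exists a => //; rewrite -enormN opprB (le_trans ba)//.
  by rewrite le_eqVlt; apply/orP; left; apply/eqP; apply: eq_integral => t _;
    rewrite distrC.
have delta0 : (0 <= \int[mu]_(t in P) `|K t - T t|%:E)%E by exact: integral_ge0.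
case: hp G1 => -> G1; rewrite /distLpA.
  rewrite normLp1; apply: (@le_trans _ _ (\int[period_mu]_x V x)%E).
    by apply: ae_le_integral_nonmeas => //; exact: measurable_abs_convolution.
  rewrite integral_abs_convolution// -[leRHS]mule1 lee_wpmul2l//.
  rewrite (le_trans _ G1)// normLp1E// le_eqVlt; apply/orP; left; apply/eqP.
  by apply: eq_integral => t _; rewrite ger0_norm.
apply: normLp_infty_le; apply: ae_impl HV => x Hx; apply: (le_trans Hx).
have -> : (\int[mu]_(t in P) `|K t - T t|%:E = \int[mu]_(t in P) `|D (x - t)%R|%:E)%E.
  rewrite (@integral_period_reflect _ (fun t => `|D t|%:E))//.
    by apply/measurable_EFinP; exact: measurableT_comp.
  by move=> t; rewrite DL.
apply: ae_ge0_le_integral; first exact: mP.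
- by move=> t _; rewrite lee_fin mulr_ge0.
- apply: measurable_funTS; apply/measurable_EFinP; apply: measurable_funM => //.
  by apply: measurableT_comp => //; exact: mshift.
- by [].
- apply: measurable_funTS; apply/measurable_EFinP.
  by apply: measurableT_comp => //; exact: mshift.
- apply/ae_period_mu; apply: ae_impl (@ae_normLp_infty R (EFin \o G)) => t Gt.
  rewrite lee_fin ler_piMr// -lee_fin (le_trans _ G1)// (le_trans _ Gt)//.
  by rewrite /= lee_fin ler_norm.
Qed.

End set_valued_bounds.

(** * Scalar approximation is a special case *)

Section comparison.
Variables (R : realType) (m n : nat).
Notation mu := (@lebesgue_measure R).
Notation P := (period_itv R).
Notation mP := (measurable_period_itv R).

(** The addition formulas separate [x] from [t] in [T (x - t)]. *)
Lemma trigpoly_convolution (T psi : R -> R) : trigpoly n T ->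
  measurable_fun P psi -> mu.-integrable P (EFin \o psi) ->
  trigpoly n (fun x => \int[mu]_(t in P) (T (x - t) * psi t)).
Proof.
move=> [a [b ->]] mpsi ipsi.
pose C (j : nat) := \int[mu]_(t in P) (psi t * cos (j%:R * t)).
pose S (j : nat) := \int[mu]_(t in P) (psi t * sin (j%:R * t)).
(* The constant term is halved in [trigpoly], so it is a case apart. *)
exists (fun j => if j is 0%N then a 0%N * \int[mu]_(t in P) psi t
                 else a j * C j - b j * S j).
exists (fun j => a j * S j + b j * C j).
have ibd (h : R -> R) : measurable_fun setT h -> (forall t, `|h t| <= 1) ->
    mu.-integrable P (EFin \o (fun t => psi t * h t)).
  move=> mh h1; apply: (@integrable_mul_bounded _ _ _ mu P mP _ _ 1) => //.
  exact: measurable_funTS.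
have ic j : mu.-integrable P (EFin \o (fun t => psi t * cos (j%:R * t))).
  apply: ibd; first exact: measurable_cosM.
  by move=> t; rewrite ler_norml cos_geN1 cos_le1.
have is_ j : mu.-integrable P (EFin \o (fun t => psi t * sin (j%:R * t))).
  apply: ibd; first exact: measurable_sinM.
  by move=> t; rewrite ler_norml sin_geN1 sin_le1.
apply/funext => x.
pose c1 j := a j * cos (j%:R * x) + b j * sin (j%:R * x).
pose c2 j := a j * sin (j%:R * x) - b j * cos (j%:R * x).
pose term j t := c1 j * (psi t * cos (j%:R * t)) + c2 j * (psi t * sin (j%:R * t)).
have iterm j : mu.-integrable P (EFin \o term j).
  rewrite (_ : _ \o _ = (fun t => (c1 j)%:E * (psi t * cos (j%:R * t))%:E) \+
    (fun t => (c2 j)%:E * (psi t * sin (j%:R * t))%:E))%E//.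
  apply: integrableD; first exact: mP.
    exact: (integrableZl mP _ (ic j)).
  exact: (integrableZl mP _ (is_ j)).
have termE j : \int[mu]_(t in P) term j t = c1 j * C j + c2 j * S j.
  rewrite RintegralD; last 3 first.
  - exact: mP.
  - exact: (integrableZl mP _ (ic j)).
  - exact: (integrableZl mP _ (is_ j)).
  by rewrite !RintegralZl//; exact: mP.
transitivity (\int[mu]_(t in P) (a 0%N / 2 * psi t + \sum_(1 <= j < n) term j t)).
  apply: eq_Rintegral => t _; rewrite mulrDl mulr_suml; congr (_ + _).
  apply: eq_bigr => j _; rewrite mulrBr cosB sinB /term /c1 /c2; ring.
rewrite RintegralD; last 3 first.
- exact: mP.
- exact: (integrableZl mP _ ipsi).
- rewrite (_ : _ \o _ = fun t => \sum_(1 <= j < n) (term j t)%:E)%E.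
    by apply: integrable_sum; [exact: mP|move=> j _; exact: iterm].
  by apply/funext => t /=; rewrite sumEFin.
rewrite RintegralZl//; last exact: mP.
rewrite Rintegral_sum//; last exact: mP.
congr (_ + _); first by ring.
apply: eq_big_nat => j /andP[j1 _]; rewrite termE /c1 /c2.
by case: j j1 => // j _; ring.
Qed.

Lemma LpA_singleton_Phi (i : 'I_m) (p : \bar R) (phi : R -> R) :
  p = 1%E \/ p = +oo%E -> F_ball p phi ->
  Phi m p (fun t => [set phi t *: delta_mx 0 i]).
Proof.
move=> hp [[phiL]]; rewrite inE => /andP[]; rewrite !inE/= => mphi _ phi1.
set e := delta_mx 0 i : 'rV[R]_m.
have normE t : set_norm [set phi t *: e] = `|phi t|%:E.
  by rewrite /set_norm hausdorff_set1 subr0 enormZ enorm_delta mulr1.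
have nphi : normLp p (EFin \o phi) = normLp p (fun t => `|phi t|%:E).
  by apply/eqP; rewrite eq_le !normLp_le// => x /=; rewrite lee_fin normr_id.
have iphi : mu.-integrable P (fun t => `|phi t|%:E).
  apply/integrable_period_mu.
    by apply/measurable_EFinP; exact: measurableT_comp.
  apply/integrableP; split.
    by apply/measurable_EFinP; exact: measurableT_comp.
  case: hp phi1 => -> phi1.
    rewrite normLp1 in phi1; rewrite (le_lt_trans _ (ltry 1))//.
    by rewrite (le_trans _ phi1)// le_eqVlt; apply/orP; left; apply/eqP;
      apply: eq_integral => t _; rewrite /= normr_id.
  apply: (@le_lt_trans _ _ (\int[period_mu]_x (cst 1%E x))%E).
    apply: ae_le_integral_nonmeas => //.
    apply: ae_impl (@ae_normLp_infty R (EFin \o phi)) => t /= tphi.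
    by rewrite normr_id (le_trans tphi).
  by rewrite (integral_cst period_mu measurableT) mul1e ltey_eq fin_num_measure.
have fineE : (fun t => fine (set_norm [set phi t *: e])) = (fun t => `|phi t|).
  by apply/funext => t; rewrite normE.
split; last first.
  rewrite /distLpA (_ : (fun _ => _) = fun t => `|phi t|%:E); first by rewrite -nphi.
  by apply/funext => t; exact: normE.
split.
  split.
  - by move=> t; split; [exact: compact_set1|exists (phi t *: e)].
  - move=> U oU; pose U' : set R := [set y | U (y *: e)].
    have oU' : open U'.
      by apply: open_comp oU => y _; exact: scalel_continuous.
    rewrite (_ : [set x | _] = setT `&` phi @^-1` U').
      by apply: mphi => //; exact: open_measurable.
    rewrite setTI; apply/seteqP; split => t /=; first by move=> [_ [->]].
    by move=> Ut; exists (phi t *: e).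
  - by move=> t; rewrite phiL.
  - by apply: eq_integrable iphi => [|t _]; [exact: mP|rewrite normE].
rewrite fineE; apply: LpP.
- exact: measurableT_comp.
- by move=> t; rewrite phiL.
- rewrite (_ : _ \o _ = fun t => `|phi t|%:E)// -nphi.
  by rewrite (le_lt_trans phi1)// ltry.
Qed.

(** The singletons [phi t *: e] along a coordinate axis [e] embed the scalar
    class. The first coordinate of a selection of [h], convolved with [T], is a
    trigonometric polynomial, and at each point its distance to the scalar
    convolution is at most the Hausdorff distance of the sets. *)
Lemma best_approx_le_calE (K : R -> R) (p : \bar R) : (0 < m)%N ->
  p = 1%E \/ p = +oo%E -> measurable_fun setT K -> periodic K (2 * pi) ->
  (best_approx (conv_class K p) (trigpoly n) p <= calE m n K p p)%E.
Proof.
move=> m0 hp mK KL; pose i := Ordinal m0.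
apply: ge_ereal_sup => _ [_ [phi Fphi <-] <-].
have [[phiL mphi] _] := Fphi.
have {}mphi : measurable_fun setT phi.
  by move: mphi; rewrite inE => /andP[]; rewrite !inE.
set e := delta_mx 0 i : 'rV[R]_m.
pose g t := [set phi t *: e].
apply: le_ereal_sup_tmp; eexists.
  exists (svconv K g) => //; exists g => //; exact: LpA_singleton_Phi.
apply: le_ereal_inf_tmp => _ [_ [T [h [tT [ch mh hL ih] ->]]] <-].
have [psi [hpsi mpsi]] := measurable_selection ch mh.
have hE t : set_norm (h t) = (fine (set_norm (h t)))%:E.
  by rewrite fineK// set_norm_fin_num; [|exact: (ch t).1|exact: (ch t).2].
have ipsi j : mu.-integrable P (fun t => (psi t 0 j)%:E).
  apply: le_integrable ih; first exact: mP.
    by apply/measurable_EFinP; exact: measurable_funTS (mpsi j).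
  move=> t _; apply: (@le_trans _ _ (enorm (psi t))%:E).
    by rewrite lee_fin ler_coord_enorm.
  exact: le_trans (enorm_le_set_norm (hpsi t)) (lee_abs _).
have tpsi := trigpoly_convolution tT (measurable_funTS (mpsi i)) (ipsi i).
set T' := (fun x => _) in tpsi.
apply: ge_ereal_inf; eexists; first by exists T'.
apply: normLp_le => // x; apply: le_trans (lee_abs _).
have [C C0 TC] := trigpoly_bounded tT.
have iT j : mu.-integrable P (fun t => (T (x - t) * psi t 0 j)%:E).
  apply: (@eq_integrable _ _ _ mu P mP (fun t => (psi t 0 j * T (x - t))%:E)).
    by move=> t _; rewrite mulrC.
  apply: (@integrable_mul_bounded _ _ _ mu P mP _ _ C).
  - exact: ipsi.
  - apply: measurable_funTS; apply: measurableT_comp (measurable_trigpoly tT) _.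
    exact: measurable_funB.
  - by move=> t _; exact: TC.
have bT := @aumann_intro R m (fun t => T (x - t)) h psi (fun t _ => hpsi t) iT.
have aK : svconv K g x `<=` [set convolution K phi x *: e].
  move=> v [w [iw aw ->]]; apply/rowP => j; rewrite !mxE.
  have mKphi : measurable_fun setT (fun t : R => K (x - t) * phi t).
    apply: measurable_funM => //; apply: measurableT_comp mK _.
    exact: measurable_funB.
  transitivity (\int[mu]_(t in P) (K (x - t) * phi t * e 0 j)).
    rewrite /Rintegral; congr fine; apply: ae_eq_integral; first exact: mP.
    - exact: measurable_int (iw j).
    - apply: measurable_funTS; apply/measurable_EFinP; exact: measurable_funM.
    - apply: ae_impl aw => t wt Pt; have [_ -> <-] := wt Pt.
      by rewrite !mxE mulrA.
  have convE : convolution K phi x = \int[mu]_(t in P) (K (x - t) * phi t).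
    rewrite /convolution -(@Rintegral_period_reflect _ _ x)//.
    - by apply: eq_Rintegral => t _; rewrite subKr.
    - apply: measurable_funM => //; apply: measurableT_comp mphi _.
      exact: measurable_funB.
    - move=> t; rewrite KL -[in LHS]phiL; congr (_ * phi _); ring.
  have eE : e 0 j = (j == i)%:R by rewrite mxE eqxx.
  rewrite convE eE eqxx/=; case: (j == i).
    by rewrite mulr1; apply: eq_Rintegral => t _; rewrite mulr1.
  by rewrite mulr0 Rintegral_eq0// => t _; rewrite mulr0.
apply: (@le_trans _ _ (enorm (convolution K phi x *: e -
  \row_j \int[mu]_(t in P) (T (x - t) * psi t 0 j)))%:E); last first.
  exact: hausdorff_ge_enorm aK bT.
rewrite /= lee_fin; apply: le_trans (ler_coord_enorm _ i).
by rewrite !mxE !eqxx mulr1.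
Qed.

End comparison.

(** * The chain of inequalities *)

Section set_valued_comparison.
Variables (R : realType) (m n : nat).
Notation mu := (@lebesgue_measure R).
Notation P := (period_itv R).

Lemma calE_le_calU (K : R -> R) (p : \bar R) :
  (calE m n K p p <= calU m n K p p)%E.
Proof.
apply: le_ereal_inf_tmp => _ [T tT <-].
apply: ge_ereal_sup => _ [_ [g Phig <-] <-].
apply: (@le_trans _ _ (distLpA p (svconv K g) (svconv T g))).
  apply: ereal_inf_lbound; exists (svconv T g) => //.
  by exists T, g; split => //; case: Phig => -[].
by apply: ereal_sup_ubound; exists g.
Qed.

Lemma calU_le (K T : R -> R) (p : \bar R) : p = 1%E \/ p = +oo%E ->
  Lp 1%E K -> trigpoly n T ->
  (calU m n K p p <= \int[mu]_(t in P) `|K t - T t|%:E)%E.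
Proof.
move=> hp /Lp1P[mK KL iK] tT; apply: ge_ereal_inf; eexists; first by exists T.
apply: ge_ereal_sup => _ [g Phig <-]; apply: distLpA_svconv_le => //.
- exact: measurable_trigpoly tT.
- exact: trigpoly_periodic tT.
- exact: trigpoly_integrable tT.
Qed.

End set_valued_comparison.

Unset Implicit Arguments.

Theorem theorem2 (R : realType) (m n : nat) (m_ge1 : (1 <= m)%N)
    (n_ge1 : (1 <= n)%N) (K : R -> R) (K_L1 : Lp 1%E K)
    (K_Nstar : cond_Nstar n K) (p : \bar R) (hp : p = 1%E \/ p = +oo%E) :
  [/\ calE m n K p p = calU m n K p p,
      calU m n K p p = best_approx (conv_class K p) (trigpoly n) p &
      best_approx (conv_class K p) (trigpoly n) p =
        normLp +oo%E (EFin \o convolution K (phi_n n))].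
Proof.
have [mK KL iK] := Lp1P K_L1.
have [T [theta [tT theta_itv sgnD]]] := K_Nstar.
set N := normLp _ _; set E := best_approx _ _ _.
have NE : (N <= E)%E.
  rewrite /N /E; case: hp => ->.
    exact: best_approx_one_ge.
  exact: best_approx_infty_ge.
have EcE : (E <= calE m n K p p)%E by exact: best_approx_le_calE.
have cEU := calE_le_calU m n K p.
have UN : (calU m n K p p <= N)%E.
  apply: le_trans (calU_le m hp K_L1 tT) _.
  exact: kernel_norm_le tT theta_itv sgnD.
split; apply/eqP; rewrite eq_le.
- by rewrite cEU (le_trans UN (le_trans NE EcE)).
- by rewrite (le_trans UN NE) (le_trans EcE cEU).
- by rewrite NE (le_trans EcE (le_trans cEU UN)).
Qed.
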